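(* Let $\kappa$ be an infinite cardinal. Assume $\mathrm{I}^-(\kappa)$, and assume that either $\Diamond_\kappa$ holds or $\kappa$ is inaccessible. Let $H\subseteq\mathrm{Inj}(\kappa)$, let $F$ be a fragment of $L_{\kappa^+\kappa}$, and let $\psi$ be a $\Sigma^1_1(L_{\kappa^+\kappa})$ sentence. Suppose that either (1) $H$ is a $K_\kappa$ subset of the $\kappa$-Baire space, or (2) $H$ is a $K_\kappa$ subset of the product space $({}^\kappa\kappa,\tau_{\mathrm{prod}})$ and $F\subseteq L_{\kappa^+\omega}$. If there is a set of at least $\kappa^+$ many models in $\mathrm{Mod}_\kappa(\psi)$ that are pairwise non-$(F,H)$-elementarily embeddable, then $\psi$ has perfectly many non-$(F,H)$-elementarily embeddable models.
   Context: $\mathrm{I}^-(\kappa)$: there is a $\kappa^+$-complete normal non-principal ideal $\mathcal I$ on $\kappa^+$ such that $\mathcal P(\kappa^+)\setminus\mathcal I$ has a dense subset $K$ (every element of $\mathcal P(\kappa^+)\setminus\mathcal I$ contains an element of $K$) in which every $\subseteq$-descending sequence of length $<\kappa$ has a lower bound in $K$; it implies $\kappa^{<\kappa}=\kappa$. The $\kappa$-Baire space is ${}^\kappa\kappa$ with topology generated by $N_p=\{x: p\subseteq x\}$, $p\in{}^{<\kappa}\kappa$; $\tau_{\mathrm{prod}}$ is the product topology on ${}^\kappa\kappa$ with $\kappa$ discrete. A subset of a space is $\kappa$-compact if every open cover of it has a subcover of size $<\kappa$, and $K_\kappa$ if it is a union of at most $\kappa$ $\kappa$-compact subsets. $\mathrm{Inj}(\kappa)$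 is the set of injective functions in ${}^\kappa\kappa$. $L$ is a relational vocabulary of size $\le\kappa$ with variables $(v_i)_{i<\kappa}$; $\mathrm{Mod}_\kappa(L)$ is the set of $L$-structures with universe $\kappa$, and valuations are elements $a\in{}^\kappa\kappa$. $L_{\lambda\mu}$ allows conjunctions/disjunctions of $<\lambda$ formulas and quantification over $<\mu$ variables, each formula having $<\mu$ free variables; subformulas are defined as usual (members of $\Phi$ are subformulas of $\bigwedge\Phi$). For $h\in{}^\kappa\kappa$, $s_h\varphi$ is obtained from $\varphi$ by simultaneously substituting $v_{h(i)}$ for $v_i$ for all $i$. A fragment of $L_{\kappa^+\kappa}$ is a set $F\subseteq L_{\kappa^+\kappa}$ with $|F|=\kappa$ containing all atomic formulas and closed under negation, subformulas and $s_h$ for all $h\in{}^\kappa\kappa$. For $H\subseteq\mathrm{Inj}(\kappa)$, $\mathcal A\in\mathrm{Mod}_\kappa(L)$ is $(F,H)$-elementarily embeddable into $\mathcal B\in\mathrm{Mod}_\kappa(L)$ if some $h\in H$ satisfies: $\mathcal A\models\varphi[a]$ iff $\mathcal B\models\varphi[h\circ a]$, for all $\varphi\in F$ and all $a\in{}^\kappa\kappa$. A set of models is pairwise non-$(F,H)$-elementarily embeddable if no member is $(F,H)$-elementarily embeddable into a different member. A $\Sigma^1_1(L_{\kappa^+\kappa})$ sentence is one of the form $\exists\bar R\,\varphi(\bar R)$ with $\bar R$ a set of $\le\kappa$ new relation symbols and $\varphi$ an $L_{\kappa^+\kappa}$ sentence of the expanded vocabulary; $\mathrm{Mod}_\kappa(\psi)$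 is the set of members of $\mathrm{Mod}_\kappa(L)$ satisfying $\psi$. Topology: ${}^F2$ carries the generalized Cantor topology with basic open sets $\{x\in{}^F2: p\subseteq x\}$, $p\in{}^\Phi2$, $\Phi\subseteq F$, $|\Phi|<\kappa$. Define $i_F:\mathrm{Mod}_\kappa(L)\to{}^F2$ by $i_F(\mathcal A)(\varphi)=1$ iff $\mathcal A\models\varphi[\mathrm{id}_\kappa]$. A set $P\subseteq\mathrm{Mod}_\kappa(L)$ is $t_F$-perfect if $i_F[P]$ is a perfect subset of ${}^F2$, where ${}^F2$ is identified with ${}^\kappa2\subseteq{}^\kappa\kappa$ via a bijection $F\to\kappa$, and $Y\subseteq{}^\kappa\kappa$ is perfect if $Y=[T]$ for a tree $T\subseteq{}^{<\kappa}\kappa$ whose nodes all have extensions in $T$ with at least two immediate successors in $T$ and in which every increasing sequence of length $<\kappa$ has an upper bound. $\psi$ has perfectly many non-$(F,H)$-elementarily embeddable models if there is a $t_F$-perfect set $P\subseteq\mathrm{Mod}_\kappa(\psi)$ of pairwise non-$(F,H)$-elementarily embeddable models. *)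

(* Defs.v *)
From HB Require Import structures.
From mathcomp Require Import all_boot all_order.
From mathcomp Require Import boolp classical_sets functions cardinality.
From mathcomp Require Import topology.

Set Implicit Arguments.
Unset Strict Implicit.
Unset Printing Implicit Defensive.

Local Open Scope classical_set_scope.
Local Open Scope card_scope.
Local Open Scope order_scope.

Definition card_lt {T U : Type} (A : set T) (B : set U) : Prop :=
  ~~ (B #<= A).
Notation "A '#<' B" := (card_lt A B)
  (at level 79, format "A  '#<'  B") : card_scope.

(* An infinite cardinal is a total order K isomorphic to an infinite initial
   ordinal. The elements of K are then the ordinals below the cardinal, and
   [set i | i < a] is the ordinal a. *)

Definition well_ordered {d} (K : orderType d) : Prop :=
  forall A : set K, A !=set0 -> exists2 m, A m & forall x, A x -> m <= x.

Definition infinite_cardinal {d} (K : orderType d) : Prop :=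
  [/\ well_ordered K, infinite_set [set: K] &
      forall a : K, [set i | i < a] #< [set: K]].

Definition successor_cardinal {d d'} (K : orderType d) (Kp : orderType d') :
    Prop :=
  [/\ infinite_cardinal Kp, [set: K] #< [set: Kp] &
      forall a : Kp, [set i | i < a] #<= [set: K]].

Definition unbounded {d} (K : orderType d) (A : set K) : Prop :=
  forall a : K, exists2 b, A b & a <= b.

Definition regular {d} (K : orderType d) : Prop :=
  forall A : set K, unbounded A -> [set: K] #<= A.

Definition strong_limit {d} (K : orderType d) : Prop :=
  forall A : set K, A #< [set: K] -> [set X : set K | X `<=` A] #< [set: K].

Definition inaccessible {d} (K : orderType d) : Prop :=
  [/\ [set: nat] #< [set: K], regular K & strong_limit K].

(* The second conjunct says that C contains every limit ordinal below the
   cardinal in which C is cofinal. *)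
Definition club {d} (K : orderType d) (C : set K) : Prop :=
  unbounded C /\
  forall l : K, (exists a, a < l) ->
    (forall a, a < l -> exists2 c, C c & a < c < l) -> C l.

Definition stationary {d} (K : orderType d) (S : set K) : Prop :=
  forall C : set K, club C -> S `&` C !=set0.

Definition diamond {d} (K : orderType d) : Prop :=
  exists A : K -> set K,
    (forall a, A a `<=` [set i | i < a]) /\
    (forall X : set K, stationary [set a | X `&` [set i | i < a] = A a]).

Definition is_ideal {T : Type} (I : set (set T)) : Prop :=
  [/\ I set0,
      forall A B : set T, A `<=` B -> I B -> I A,
      forall A B : set T, I A -> I B -> I (A `|` B) &
      ~ I [set: T]].

Definition complete_ideal {T U : Type} (lam : set U) (I : set (set T)) : Prop :=
  forall C : set (set T), C `<=` I -> C #< lam -> I (\bigcup_(A in C) A).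

(* Closure under diagonal unions. *)
Definition normal_ideal {d} (T : orderType d) (I : set (set T)) : Prop :=
  forall X : T -> set T, (forall a, I (X a)) ->
    I [set b | exists2 a, a < b & X a b].

Definition principal_ideal {T : Type} (I : set (set T)) : Prop :=
  exists A : set T, I = [set X | X `<=` A].

Definition dense_in {T : Type} (D P : set (set T)) : Prop :=
  D `<=` P /\ forall X, P X -> exists2 Y, D Y & Y `<=` X.

(* Sequences of length a, for a below the cardinal K, are functions on K of
   which only the values below a matter. *)
Definition descending_closed {d} (K : orderType d) {T : Type}
    (D : set (set T)) : Prop :=
  forall (a : K) (s : K -> set T),
    (forall i, i < a -> D (s i)) ->
    (forall i j, i <= j -> j < a -> s j `<=` s i) ->
    exists2 Y, D Y & forall i, i < a -> Y `<=` s i.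

(* Kp is meant to be the successor cardinal of K. *)
Definition I_minus {d d'} (K : orderType d) (Kp : orderType d') : Prop :=
  exists I : set (set Kp),
    [/\ is_ideal I, complete_ideal [set: Kp] I, normal_ideal I,
        ~ principal_ideal I &
        exists2 D : set (set Kp),
          dense_in D (~` I) & descending_closed K D].

Definition pfun {d} (K : orderType d) : Type := K -> option K.
HB.instance Definition _ {d} (K : orderType d) := Pointed.on (pfun K).

Definition has_length {d} (K : orderType d) (p : pfun K) (a : K) : Prop :=
  forall i, isSome (p i) = (i < a).

(* The sequences of elements of K of length below the cardinal K. *)
Definition short_seq {d} (K : orderType d) : set (pfun K) :=
  [set p | exists a, has_length p a].
Arguments short_seq {d} K.

Definition pfun_sub {d} (K : orderType d) (p q : pfun K) : Prop :=
  forall i x, p i = Some x -> q i = Some x.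

Definition restr {d} (K : orderType d) (x : K -> K) (a : K) : pfun K :=
  fun i => if i < a then Some (x i) else None.

Definition baire {d} (K : orderType d) : Type := K -> K.
HB.instance Definition _ {d} (K : orderType d) := Choice.on (baire K).

Definition baire_nbhd {d} (K : orderType d) (p : pfun K) : set (baire K) :=
  [set x | pfun_sub p (fun i => Some (x i))].

HB.instance Definition _ {d} (K : orderType d) :=
  isSubBaseTopological.Build (baire K) (short_seq K) (@baire_nbhd d K).

Definition kappa_compact {U : Type} (lam : set U) (T : topologicalType)
    (A : set T) : Prop :=
  forall C : set (set T), (forall O, C O -> open O) ->
    A `<=` \bigcup_(O in C) O ->
    exists C' : set (set T),
      [/\ C' `<=` C, C' #< lam & A `<=` \bigcup_(O in C') O].

Definition K_kappa {U : Type} (lam : set U) (T : topologicalType)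
    (A : set T) : Prop :=
  exists S : set (set T),
    [/\ S #<= lam, forall B, S B -> kappa_compact lam B &
        A = \bigcup_(B in S) B].

Definition is_tree {d} (K : orderType d) (T : set (pfun K)) : Prop :=
  T `<=` short_seq K /\
  forall p q : pfun K, short_seq K p -> pfun_sub p q -> T q -> T p.

Definition branches {d} (K : orderType d) (T : set (pfun K)) : set (K -> K) :=
  [set x | forall a, T (restr x a)].

Definition immediate_successor {d} (K : orderType d) (p q : pfun K) : Prop :=
  exists a x, has_length p a /\
    q = (fun i => if i == a then Some x else p i).

Definition cofinally_splitting {d} (K : orderType d) (T : set (pfun K)) :
    Prop :=
  forall p, T p -> exists q, [/\ T q, pfun_sub p q &
    exists q1 q2, [/\ T q1, T q2, immediate_successor q q1,
                      immediate_successor q q2 & q1 <> q2]].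

(* The sequence of length 0 is included, so T is nonempty. *)
Definition increasing_closed {d} (K : orderType d) (T : set (pfun K)) : Prop :=
  forall (a : K) (s : K -> pfun K),
    (forall i, i < a -> T (s i)) ->
    (forall i j, i <= j -> j < a -> pfun_sub (s i) (s j)) ->
    exists2 q, T q & forall i, i < a -> pfun_sub (s i) q.

Definition perfect_subset {d} (K : orderType d) (Y : set (K -> K)) : Prop :=
  exists T : set (pfun K),
    [/\ is_tree T, cofinally_splitting T, increasing_closed T &
        Y = branches T].

(* The inclusion of the functions K -> 2 in the functions K -> K: the bit b
   becomes the ordinal that has exactly b predecessors. *)
Definition cantor_in_baire {d} (K : orderType d) (Y : set (K -> bool)) :
    set (K -> K) :=
  [set x | exists2 y, Y y & forall i, [set j | j < x i] #= `I_(y i)].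

Record vocabulary := Vocabulary { relsym : Type; arity : relsym -> nat }.

(* A variable is an element of K. Conjunctions and disjunctions are taken over
   families indexed by subsets of K, that is, they have fewer than K^+
   members; two families with the same range are two distinct formulas. A
   quantifier binds a set V of variables at once. *)
Inductive fml (K : Type) (L : vocabulary) : Type :=
| Equ (i j : K)
| Rel (R : relsym L) (t : (arity R).-tuple K)
| Neg (phi : fml K L)
| And (J : set K) (Phi : J -> fml K L)
| Or (J : set K) (Phi : J -> fml K L)
| Ex (V : set K) (phi : fml K L)
| All (V : set K) (phi : fml K L).
Arguments Equ {K L}.
Arguments Rel {K L}.

Section Syntax.
Context {K : Type} {L : vocabulary}.
Implicit Types phi chi : fml K L.

Fixpoint fv phi : set K :=
  match phi with
  | Equ i j => [set i; j]
  | Rel R t => [set i | exists k, i = tnth t k]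
  | Neg phi => fv phi
  | And J Phi | Or J Phi => [set i | exists k : J, fv (Phi k) i]
  | Ex V phi | All V phi => fv phi `\` V
  end.

(* The formulas of L_{K^+ mu}, the cardinal mu being that of the type mu. *)
Fixpoint in_logic (mu : Type) phi : Prop :=
  fv phi #< [set: mu] /\
  match phi with
  | Equ _ _ | Rel _ _ => True
  | Neg phi => in_logic mu phi
  | And J Phi | Or J Phi => forall k : J, in_logic mu (Phi k)
  | Ex V phi | All V phi => V #< [set: mu] /\ in_logic mu phi
  end.

Fixpoint subformula chi phi : Prop :=
  chi = phi \/
  match phi with
  | Equ _ _ | Rel _ _ => False
  | Neg phi => subformula chi phi
  | And J Phi | Or J Phi => exists k : J, subformula chi (Phi k)
  | Ex V phi | All V phi => subformula chi phi
  end.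

(* is_subst h phi phi': phi' is the result s_h phi of substituting v_{h i} for
   the free occurrences of v_i in phi, for all i at once. Bound variables are
   renamed so that no capture occurs, and any choice of the new names is
   accepted: under a quantifier over V, h is replaced by a function g that
   agrees with h on the free variables, and that maps V injectively onto a set
   V' containing no image of a free variable. Only the set of members of a
   conjunction matters. *)
Fixpoint is_subst (h : K -> K) phi phi' : Prop :=
  let rename (V V' : set K) (X : set K) (g : K -> K) :=
    [/\ forall i, X i -> g i = h i, set_bij V V' g &
        forall i, X i -> ~ V' (g i)] in
  match phi with
  | Equ i j => phi' = Equ (h i) (h j)
  | Rel R t => phi' = Rel R (map_tuple h t)
  | Neg phi => exists2 chi, phi' = Neg chi & is_subst h phi chi
  | And J Phi => exists (J' : set K) (Psi : J' -> fml K L),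
      [/\ phi' = And Psi,
          forall k, exists l, is_subst h (Phi k) (Psi l) &
          forall l, exists k, is_subst h (Phi k) (Psi l)]
  | Or J Phi => exists (J' : set K) (Psi : J' -> fml K L),
      [/\ phi' = Or Psi,
          forall k, exists l, is_subst h (Phi k) (Psi l) &
          forall l, exists k, is_subst h (Phi k) (Psi l)]
  | Ex V phi => exists V' chi g,
      [/\ phi' = Ex V' chi, rename V V' (fv phi `\` V) g & is_subst g phi chi]
  | All V phi => exists V' chi g,
      [/\ phi' = All V' chi, rename V V' (fv phi `\` V) g & is_subst g phi chi]
  end.

Definition fragment (F : set (fml K L)) : Prop :=
  [/\ F `<=` in_logic K, F #= [set: K],
      (forall i j, F (Equ i j)) /\ (forall R t, F (Rel R t)) &
      [/\ forall phi, F phi -> F (Neg phi),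
          forall phi chi, F phi -> subformula chi phi -> F chi &
          forall h phi, F phi -> exists2 phi', F phi' & is_subst h phi phi']].

End Syntax.

(* The structures with universe K. *)
Definition Mod (K : Type) (L : vocabulary) : Type :=
  forall R : relsym L, (arity R).-tuple K -> Prop.

Fixpoint sat {K : Type} {L : vocabulary} (A : Mod K L) (a : K -> K)
    (phi : fml K L) : Prop :=
  match phi with
  | Equ i j => a i = a j
  | Rel R t => A R (map_tuple a t)
  | Neg phi => ~ sat A a phi
  | And J Phi => forall k : J, sat A a (Phi k)
  | Or J Phi => exists k : J, sat A a (Phi k)
  | Ex V phi => exists b, (forall i, ~ V i -> b i = a i) /\ sat A b phi
  | All V phi => forall b, (forall i, ~ V i -> b i = a i) -> sat A b phi
  end.

Definition voc_sum (L M : vocabulary) : vocabulary :=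
  {| relsym := relsym L + relsym M;
     arity := fun s => match s with inl R => arity R | inr R => arity R end |}.

Definition expansion {K : Type} {L M : vocabulary} (A : Mod K L) (B : Mod K M) :
    Mod K (voc_sum L M) :=
  fun s => match s with inl R => A R | inr R => B R end.

Record sigma11 (K : Type) (L : vocabulary) := Sigma11 {
  new_rel : vocabulary;
  new_relP : [set: relsym new_rel] #<= [set: K];
  sigma_matrix : fml K (voc_sum L new_rel);
  sigma_matrix_logic : in_logic K sigma_matrix;
  sigma_matrix_closed : fv sigma_matrix = set0
}.

Definition models {K : Type} {L : vocabulary} (psi : sigma11 K L) :
    set (Mod K L) :=
  [set A | exists B : Mod K (new_rel psi),
     forall a, sat (expansion A B) a (sigma_matrix psi)].

Section Embeddability.
Context {d : Order.disp_t} {K : orderType d} {L : vocabulary}.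
Implicit Types (F : set (fml K L)) (H : set (K -> K)) (P : set (Mod K L)).

Definition elem_embeddable F H (A B : Mod K L) : Prop :=
  exists2 h, H h &
    forall phi a, F phi -> (sat A a phi <-> sat B (h \o a) phi).

Definition pairwise_non_embeddable F H P : Prop :=
  forall A B, P A -> P B -> A <> B -> ~ elem_embeddable F H A B.

Definition i_map F (A : Mod K L) : F -> bool :=
  fun phi => `[< sat A id (val phi) >].

(* e is the bijection through which the functions F -> 2 are identified with
   the functions K -> 2. *)
Definition t_perfect F (e : F -> K) P : Prop :=
  perfect_subset (cantor_in_baire
    [set y : K -> bool | (@i_map F @` P) (fun phi => y (e phi))]).

Definition perfectly_many F (e : F -> K) H (psi : sigma11 K L) : Prop :=
  exists P, [/\ P `<=` models psi, t_perfect e P &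
                pairwise_non_embeddable F H P].

End Embeddability.

(* Main.v *)
(* Let (A_t), for t below the successor of K, be pairwise non-embeddable models,
   and let D be the dense closed family of positive sets. On a member of D, any
   function with at most K values is constant on a smaller member, so D can be
   used like a notion of forcing: along a descending K-sequence in D that
   decides every formula, with witnesses, the models converge to a limit model
   in which truth is what was decided. Hence limits of models of a Sigma^1_1
   sentence are models of it, and a binary tree of members of D gives a perfect
   family.

   As H is a union of K many kappa-compact sets H_i, embeddability by H_i is a
   closed relation, and any two nodes of the tree can be shrunk so that no model
   through the first embeds by H_i in a model through the second: take distinct
   t and u that are approximated to any length by members of D below the two
   nodes. There may be too many pairs of nodes at a level to treat all of them.
   Only fewer than K pairs are treated at each level, namely all pairs if K is
   inaccessible and a guessed one under diamond, but each pair of branches is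
   treated cofinally often.

   The cardinal arithmetic comes from D too: a set has at most K elements if any
   function into it from the successor of K is constant on a member of D, and K
   is regular because otherwise surjections from K onto the ordinals below its
   successor could be decided on a member of D, by normality. *)

From HB Require Import structures.
Require Import Defs.
From mathcomp Require Import all_boot all_order.
From mathcomp Require Import boolp classical_sets functions cardinality.
From mathcomp Require Import finmap topology.

Set Implicit Arguments.
Unset Strict Implicit.
Unset Printing Implicit Defensive.

Import Order.TTheory.
Local Open Scope order_scope.
Local Open Scope classical_set_scope.
Local Open Scope card_scope.

(** * Cardinals and well-orders *)

Lemma inj_in_card_le {T U} (A : set T) (B : set U) (f : T -> U) :
  (forall x, A x -> B (f x)) ->
  (forall x y, A x -> A y -> f x = f y -> x = y) -> A #<= B.
Proof.
move=> fB fI.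
have : f @` A #= A by apply: inj_card_eq => x y /set_mem Ax /set_mem Ay;
  exact: fI.
rewrite card_eq_le => /andP [_ /card_le_trans]; apply.
by apply: subset_card_le => _ [x Ax <-]; exact: fB.
Qed.

Lemma card_le_injT {T U} (B : set U) :
  [set: T] #<= B -> exists2 f : T -> U, (forall x, B (f x)) & injective f.
Proof.
move=> /card_leP [f].
exists (fun x => set_val (f (SigSub (mem_set (I : [set: T] x))))) => [x|x y].
  exact: set_valP.
by move=> /val_inj /(@inj _ _ _ f); rewrite !in_setT => /(_ isT isT) [].
Qed.

Lemma card_le_surj {T U} (A : set T) (B : set U) :
  A #<= B -> A = set0 \/ exists f : U -> T, A = f @` B.
Proof. by move=> /pfcard_geP [|/surjfunPex]; [left|right]. Qed.

Lemma set_type_card_le {T} (A : set T) : [set: A] #<= [set: T].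
Proof.
apply: card_le_trans (card_leT A).
by have := card_setT A; rewrite card_eq_le => /andP [].
Qed.

Lemma card_le_lt_trans {T U V} (A : set T) (B : set U) (C : set V) :
  A #<= B -> B #< C -> A #< C.
Proof.
by move=> AB; apply: contra => /card_le_trans; exact.
Qed.

Section WellOrder.
Context {d : Order.disp_t} {W : orderType d} (Wwo : well_ordered W).

Lemma wo_wf : well_founded (fun x y : W => x < y).
Proof.
move=> a; apply: contrapT => na.
have [m nm mmin] := Wwo (ex_intro [set x | ~ Acc _ x] a na).
apply: nm; constructor => y ym; apply: contrapT => ny.
by have := mmin y ny; rewrite leNgt ym.
Qed.

Lemma wo_ind (P : W -> Prop) :
  (forall a, (forall i, i < a -> P i) -> P a) -> forall a, P a.
Proof. exact: (well_founded_ind wo_wf). Qed.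

(** Histories are total functions; as [R] is local, only the values below the current stage count,
    and [t0] fills the rest. A stage without a witness would get [t0] too, but induction shows that
    there is none. *)
Lemma wo_dependent_choice (T : Type) (R : W -> (W -> T) -> T -> Prop) :
  T ->
  (forall a f g t, (forall i, i < a -> f i = g i) -> R a f t -> R a g t) ->
  (forall a f, (forall i, i < a -> R i f (f i)) -> exists t, R a f t) ->
  exists f, forall a, R a f (f a).
Proof.
move=> t0 Rloc Rex.
pose ext a (r : forall y, y < a -> T) (i : W) : T :=
  if pselect (i < a) is left h then r i h else t0.
pose F a (r : forall y, y < a -> T) : T :=
  if pselect (exists t, R a (ext a r) t) is left h then projT1 (cid h) else t0.
pose f : W -> T := Fix wo_wf (fun=> T) F.
have fE a : f a = F a (fun y _ => f y).
  rewrite /f Fix_eq // => x r r' rr'; congr (F x).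
  by apply: functional_extensionality_dep => y; apply: funext => h.
have extE a i : i < a -> ext a (fun y _ => f y) i = f i.
  by rewrite /ext; case: pselect.
exists f; apply: wo_ind => a IH.
have [t Rt] := Rex a f IH.
have {}Rt : R a (ext a (fun y _ => f y)) t.
  by apply: Rloc Rt => i ia; rewrite extE.
rewrite fE /F; case: pselect => [h|]; last by case; exists t.
by apply: Rloc (projT2 (cid h)) => i ia; rewrite extE.
Qed.

(** Choose new elements of A along W. Either this never stops and gives an injection, or it stops at
    some a, and the elements chosen before a exhaust A. *)
Lemma card_le_wo {T} (A : set T) :
  [set: W] #<= A \/ exists a : W, A #<= [set i | i < a].
Proof.
have [[w _]|/nonemptyPn W0] := pselect ([set: W] !=set0); last first.
  by left; rewrite W0; exact: card_ge0.
have [[t0 At0]|/nonemptyPn ->] := pselect (A !=set0); last first.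
  by right; exists w; exact: card_ge0.
pose R (a : W) (f : W -> T) t := A t /\ forall i, i < a -> f i <> t.
have [Rex|] := pselect (forall a f, (forall i, i < a -> R i f (f i)) ->
                          exists t, R a f t).
  left; have [|f Rf] := @wo_dependent_choice T R t0 _ Rex.
    by move=> a f g t fg [At ft]; split=> // i ia; rewrite -fg //; exact: ft.
  apply: (inj_in_card_le (f := f)) => [x _|x y _ _ fxy]; first by case: (Rf x).
  by case: (ltgtP x y) => // xy; exfalso;
    [have [_ /(_ _ xy)] := Rf y | have [_ /(_ _ xy)] := Rf x]; rewrite fxy.
move=> /existsNP [a /existsNP [f /not_implyP [Rf nR]]]; right; exists a.
apply: card_le_trans (card_image_le f [set i | i < a]); apply: subset_card_le.
move=> t At; apply: contrapT => nt; apply: nR; exists t; split=> // i ia fit.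
by apply: nt; exists i.
Qed.

Lemma card_lt_wo {T} (A : set T) :
  A #< [set: W] -> exists a : W, A #<= [set i | i < a].
Proof. by move=> /negP nA; case: (card_le_wo A) => // /nA. Qed.

Lemma wo_lub (P : set W) (b : W) : (forall x, P x -> x <= b) ->
  exists l, (forall x, P x -> x <= l) /\
    (forall c, (forall x, P x -> x <= c) -> l <= c).
Proof.
move=> Pb; have [|l Pl lmin] := @Wwo [set c | forall x, P x -> x <= c].
  by exists b.
by exists l.
Qed.

Lemma strict_mono_ge (f : W -> W) : (forall i j, i < j -> f i < f j) ->
  forall i, i <= f i.
Proof.
move=> fm; apply: wo_ind => i IH; rewrite leNgt; apply/negP => fi.
by have := IH _ fi; rewrite leNgt (fm _ _ fi).
Qed.

End WellOrder.

(** * Closed orders and fusion *)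

Definition lt_closed {d} (K : orderType d) {St} (le : St -> St -> Prop) :=
  forall (a : K) (s : K -> St),
    (forall i j, i <= j -> j < a -> le (s j) (s i)) ->
    exists y, forall i, i < a -> le y (s i).

Definition dense_open {St} (le : St -> St -> Prop) (P : St -> Prop) :=
  (forall x y, le y x -> P x -> P y) /\ forall x, exists2 y, le y x & P y.

Lemma lt_closed_below {d} {K : orderType d} {St} {le : St -> St -> Prop} :
  (forall x, le x x) -> (forall x y z, le x y -> le y z -> le x z) ->
  lt_closed K le ->
  forall x (a : K) s, (forall i, i < a -> le (s i) x) ->
    (forall i j, i <= j -> j < a -> le (s j) (s i)) ->
    exists2 y, le y x & forall i, i < a -> le y (s i).
Proof.
move=> le_refl le_trans cl x a s sx sd; have [y ys] := cl a s sd.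
(* A lower bound of the empty sequence need not lie below [x]; then [x] itself is taken. *)
have [[i ia]|n] := pselect (exists i, i < a).
  by exists y => //; exact: le_trans (ys i ia) (sx i ia).
by exists x => // i ia; case: n; exists i.
Qed.

(** Read [le y x] as y refining x. The dense open sets are listed along a proper initial segment of
    K and entered one after another, with closure giving lower bounds; openness preserves what was
    reached. *)
Lemma fusion {d} {K : orderType d} {St} {le : St -> St -> Prop} :
  well_ordered K ->
  (forall x, le x x) -> (forall x y z, le x y -> le y z -> le x z) ->
  lt_closed K le ->
  forall I (A : set I) (P : I -> St -> Prop), A #< [set: K] ->
    (forall i, A i -> dense_open le (P i)) ->
    forall x, exists2 y, le y x & forall i, A i -> P i y.
Proof.
move=> Kwo le_refl le_trans cl I A P /(card_lt_wo Kwo) [a].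
move=> /card_le_surj [-> _ x|[f ->] Pd x]; first by exists x.
pose R (i : K) (g : K -> St) t :=
  [/\ le t x, forall j, j < i -> le t (g j) & i < a -> P (f i) t].
have clx := lt_closed_below le_refl le_trans cl.
have [||g Rg] := @wo_dependent_choice _ _ Kwo St R x.
- move=> b g h t gh [tx tg tP]; split=> // j jb; rewrite -gh //; exact: tg.
- move=> b g IH.
  have [|i j ij jb|y yx yg] := clx x b g.
  + by move=> i /IH [].
  + have [_ gj _] := IH j jb.
    by move: ij; rewrite le_eqVlt => /predU1P [->|]; [exact: le_refl|exact: gj].
  have [ba|/negP nba] := boolP (b < a); last by exists y; split.
  have [|_ /(_ y) [z zy Pz]] := Pd (f b); first by exists b.
  exists z; split=> //; first exact: le_trans zy yx.
  by move=> j jb; exact: le_trans zy (yg j jb).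
have [|i j ij ja|y yx yg] := clx x a g.
- by move=> i _; case: (Rg i).
- have [_ gj _] := Rg j.
  by move: ij; rewrite le_eqVlt => /predU1P [->|]; [exact: le_refl|exact: gj].
exists y => // _ [i ia <-].
have [|Po _] := Pd (f i); first by exists i.
by apply: Po (yg i ia) _; case: (Rg i) => _ _; exact.
Qed.

(** With a maximum [k], K would inject into the points below [k], as in Hilbert's hotel: along a
    sequence [g] of such points each moves up one place, and [k] gets the first place. *)
Lemma infinite_cardinal_no_max {d} (K : orderType d) :
  infinite_cardinal K -> forall k : K, exists k', k < k'.
Proof.
move=> [Kwo Kinf Kini] k; apply: contrapT => /forallNP kmax.
have lek x : x <= k by rewrite leNgt; apply/negP.
have inf : infinite_set [set i | i < k].
  move=> fin; apply: Kinf; apply: (@sub_finite_set _ _ ([set i | i < k] `|`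
    [set k])).
    move=> x _; have := lek x; rewrite le_eqVlt => /predU1P [->|xk];
      first by right.
    by left.
  by rewrite finite_setU; split=> //; exact: finite_set1.
have /card_le_injT [g gk ginj] := (infiniteP _).1 inf.
have /negP := Kini k; apply.
pose f x := if x == k then g 0%N else
  if pselect (exists n, g n = x) is left h then g (projT1 (cid h)).+1 else x.
have fg n : f (g n) = g n.+1.
  rewrite /f; have /lt_eqF -> := gk n; case: pselect => [h|[]];
    last by exists n.
  by congr g; congr S; apply: ginj; exact: projT2 (cid h).
have fk : f k = g 0%N by rewrite /f eqxx.
have fN x : x <> k -> (forall n, g n <> x) -> f x = x.
  move=> /eqP/negbTE xk gx; rewrite /f xk; case: pselect => // h.
  by exfalso; case: h => n /gx.
have fP x : [\/ x = k, exists n, x = g n | x <> k /\ forall n, g n <> x].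
  have [|xk] := pselect (x = k); first by constructor 1.
  have [[n gn]|gx] := pselect (exists n, g n = x); first by constructor 2;
    exists n.
  by constructor 3; split=> // n gn; apply: gx; exists n.
apply: (inj_in_card_le (f := f)) => [x _|x y _ _].
  case: (fP x) => [->|[n ->]|[xk gx]]; rewrite ?fk ?fg ?fN //; try exact: gk.
  by rewrite /= lt_neqAle lek andbT; apply/eqP.
case: (fP x) => [->|[n ->]|[xk gx]]; case: (fP y) => [->|[m ->]|[yk gy]];
  rewrite ?fk ?fg ?fN //.
- by move=> /ginj.
- by move=> /gy.
- by move=> /ginj.
- by move=> /ginj [->].
- by move=> /gy.
- by move=> /esym /gx.
- by move=> /esym /gx.
Qed.

(** * Deciding bases from the ideal *)

(* What the construction uses of the positive sets of the ideal: D plays the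
   role of the dense family of positive sets. *)
Definition deciding_base {d} (K : orderType d) {T} (D : set (set T)) : Prop :=
  [/\ D !=set0,
      forall X, D X -> exists t u, [/\ X t, X u & t <> u],
      forall X (f : T -> K), D X ->
        exists Y k, [/\ D Y, Y `<=` X & forall t, Y t -> f t = k] &
      descending_closed K D].

Section Base.
Context {d : Order.disp_t} {K : orderType d} {T : Type} {D : set (set T)}.
Context (Kwo : well_ordered K) (Dcl : descending_closed K D).

Lemma base_fusion I (A : set I) (P : I -> set T -> Prop) :
  A #< [set: K] ->
  (forall i X Y, A i -> Y `<=` X -> P i X -> P i Y) ->
  (forall i X, A i -> D X -> exists Y, [/\ D Y, Y `<=` X & P i Y]) ->
  forall X, D X -> exists Y, [/\ D Y, Y `<=` X & forall i, A i -> P i Y].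
Proof.
move=> AK Po Pd X DX.
pose le (Y X : {X | D X}) := projT1 Y `<=` projT1 X.
have [||||[Y DY] YX YP] := @fusion _ K {X | D X} le Kwo _ _ _ I A
  (fun i X => P i (projT1 X)) AK _ (exist _ X DX).
- by move=> Y.
- by move=> Y Z V YZ ZV; exact: subset_trans YZ ZV.
- move=> a s sd; have [i _|//|Y DY Ys] := Dcl (a := a) (s :=
    fun i => projT1 (s i)).
    exact: projT2 (s i).
  by exists (exist _ Y DY).
- move=> i Ai; split=> [[x Dx] [y Dy]|[Z DZ]]; first exact: Po.
  by have [Y [DY YZ YP]] := Pd i Z Ai DZ; exists (exist _ Y DY).
by exists Y; split.
Qed.

End Base.

(** By completeness, one of K many pieces of a positive set is positive, which decides functions
    into K. Normality gives Fodor's lemma for regressive functions, from which regularity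
    follows. *)
Lemma I_minus_base {d d'} (K : orderType d) (Kp : orderType d') :
  infinite_cardinal K -> successor_cardinal K Kp -> I_minus K Kp ->
  regular K /\ exists D : set (set Kp), deciding_base K D.
Proof.
move=> Kcard [[Kpwo Kpinf Kpini] KKp Kp_le] [I [[I0 Isub IU IT] Ic In Ip [D [DI
  Dd] Dcl]]].
have [Kwo Kinf Kini] := Kcard.
(* Non-principality does not exclude that some singletons are positive, but
   the set B of the null points is positive, and we work below it. *)
pose B := [set a | I [set a]].
have nIB : ~ I B.
  move=> IB; apply: Ip; exists B; apply/seteqP; split=> X /= IX;
    last exact: Isub IB.
  by move=> a Xa; apply: Isub IX => _ ->.
have Isplit X (f : Kp -> K) : ~ I X -> exists k, ~ I (X `&` [set a | f a = k]).
  move=> nIX; apply: contrapT => /forallNP Ik; apply: nIX.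
  pose C := range (fun k => X `&` [set a | f a = k]).
  have : I (\bigcup_(A in C) A).
    apply: Ic => [_ [k _ <-]|]; first exact: contrapT (Ik k).
    exact: card_le_lt_trans (card_image_le _ _) KKp.
  apply: Isub => a Xa; exists (X `&` [set b | f b = f a]) => //.
  by exists (f a).
have Ipress X (f : Kp -> Kp) : (forall b, X b -> f b < b) -> ~ I X ->
    exists k, ~ I (X `&` [set a | f a = k]).
  move=> fr nIX; apply: contrapT => /forallNP Ik; apply: nIX.
  have := In (fun k => X `&` [set a | f a = k]) (fun k => contrapT (Ik k)).
  by apply: Isub => b Xb; exists (f b); [exact: fr|].
pose D' := D `&` [set Y | Y `<=` B].
have D'I X : D' X -> ~ I X by move=> [/DI].
have D'd X : X `<=` B -> ~ I X -> exists2 Y, D' Y & Y `<=` X.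
  move=> XB /Dd [Y DY YX]; exists Y => //; split=> //.
  exact: subset_trans YX XB.
have D'cl : descending_closed K D'.
  move=> a s sD sd; have [[i ia]|n] := pselect (exists i, i < a); last first.
    have [Y D'Y _] := D'd _ (@subset_refl _ B) nIB.
    by exists Y => // i ia; case: n; exists i.
  have [j ja|//|Y DY Ys] := Dcl a s; first by case: (sD j ja).
  exists Y => //; split=> //; apply: subset_trans (Ys i ia) _.
  by case: (sD i ia).
have D'1 X t : D' X -> ~ I (X `\ t).
  move=> D'X IXt; apply: (D'I X D'X); have [Bt|nBt] := pselect (B t).
    apply: Isub (IU _ _ IXt Bt) => x Xx.
    by have [->|xt] := pselect (x = t); [right|left].
  by apply: Isub IXt => x Xx; split=> // xt; apply: nBt; rewrite -xt;
    case: D'X => _; exact.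
have D'2 X : D' X -> exists t u, [/\ X t, X u & t <> u].
  move=> D'X; have [t Xt] : X !=set0.
    by apply/set0P/eqP => X0; apply: (D'I X) => //; rewrite X0.
  apply: contrapT => n; apply: (D'1 X t) => //.
  by apply: Isub I0 => x [Xx xt]; apply: n; exists x, t.
split; last first.
  exists D'; split=> //.
    by have [Y D'Y _] := D'd _ (@subset_refl _ B) nIB; exists Y.
  move=> X f D'X; have [k nI] := Isplit X f (D'I X D'X).
  have [|Y D'Y YX] := D'd _ _ nI.
    by move=> x [Xx _]; case: D'X => _; exact.
  by exists Y, k; split=> // t; move=> /YX [].
(* Otherwise a cofinal set of fewer than K many stages decides, on a single
   set in D', a whole enumeration of each of its members. *)
move=> A Aunb; apply: contrapT => /negP AK.
have /choice [f fP] : forall b, exists g : K -> Kp,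
    [set i | i < b] = set0 \/ [set i | i < b] = range g.
  move=> b.
  have [e0|[g gP]] := card_le_surj (Kp_le b); last by exists g; right.
  by exists (fun=> b); left.
(* The least point [z] has no predecessors to enumerate, so [f] is not regressive there; it will be
   removed from the sets in question. *)
have [z _ zmin] := Kpwo _ (infinite_setN0 Kpinf).
have fK b k : b <> z -> f b k < b.
  move=> bz; have zb : z < b by rewrite lt_neqAle zmin // andbT;
    apply/eqP => /esym.
  have [/seteqP [+ _]|/seteqP [_]] := fP b; first by move=> /(_ z zb).
  by apply; exists k.
have press k X : D' X ->
    exists Y, [/\ D' Y, Y `<=` X & exists c, forall b, Y b -> f b k = c].
  move=> D'X; have [|c nI] := Ipress (X `\ z) (fun b => f b k) _ (D'1 X z D'X).
    by move=> b [_]; exact: fK.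
  have [|Y D'Y YX] := D'd _ _ nI.
    by move=> x [[Xx _] _]; case: D'X => _; exact.
  exists Y; split=> //; first by move=> y /YX [[]].
  by exists c => b /YX [].
have dec k X : D' X -> exists Y, [/\ D' Y, Y `<=` X &
    forall i, i < k -> exists c, forall b, Y b -> f b i = c].
  apply: (base_fusion Kwo D'cl (A := [set i | i < k])
    (P := fun i Y => exists c, forall b, Y b -> f b i = c)).
  - exact: Kini.
  - by move=> i X0 Y _ YX [c Xc]; exists c => b /YX /Xc.
  - by move=> i X0 _; exact: press.
have [X0 D'X0 _] := D'd _ (@subset_refl _ B) nIB.
have [|||Y [D'Y _ Yc]] := base_fusion Kwo D'cl (A := A)
    (P := fun k Y => forall i, i < k -> exists c, forall b, Y b -> f b i = c)
    _ _ _ D'X0.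
- exact: AK.
- by move=> k X Y _ YX Xc i /Xc [c ic]; exists c => b /YX /ic.
- by move=> k X _; exact: dec.
(* As [A] is unbounded, every index k lies below a member of [A]; so all members of [Y] share one
   enumeration. *)
have Yf b b' k : Y b -> Y b' -> f b k = f b' k.
  move=> Yb Yb'; have [k' kk'] := infinite_cardinal_no_max Kcard k.
  have [a Aa k'a] := Aunb k'; have [c fc] := Yc a Aa k (lt_le_trans kk' k'a).
  by rewrite !fc.
have [|Z D'Z ZY] := D'd (Y `\ z) _ (D'1 Y z D'Y).
  by move=> x [Yx _]; case: D'Y => _; exact.
(* If b < b', then b occurs in the enumeration for b', hence in the one for b, whose terms are all
   below b. *)
have Zlt b b' : Z b -> Z b' -> ~ b < b'.
  move=> /ZY [Yb bz] /ZY [Yb' _] bb'.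
  have [/seteqP [+ _]|/seteqP [+ _]] := fP b'; first by move=> /(_ b bb').
  move=> /(_ b bb') [k _ fk]; have := fK b k bz.
  by rewrite (Yf b b') // fk ltxx.
have [u [v [Zu Zv uv]]] := D'2 Z D'Z.
by case: (ltgtP u v) => // [/(Zlt u v)|/(Zlt v u)]; exact.
Qed.

Lemma infinite_cardinal_succ {d} (K : orderType d) :
  infinite_cardinal K -> exists2 s : K -> K, (forall i, i < s i) &
    forall i j, (j < s i) = (j <= i).
Proof.
move=> Kcard; have [Kwo _ _] := Kcard.
have /choice [s sP] : forall i : K, exists s, i < s /\ forall j, i < j ->
  s <= j.
  move=> i; have [j ij] := infinite_cardinal_no_max Kcard i.
  have [s si smin] := Kwo [set k | i < k] (ex_intro _ j ij).
  by exists s.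
exists s => [i|i j]; first by case: (sP i).
have [i_s smin] := sP i; apply/idP/idP => [js|ji];
  last exact: le_lt_trans ji i_s.
by rewrite leNgt; apply/negP => /smin; rewrite leNgt js.
Qed.

Lemma regular_bounded {d} (K : orderType d) (A : set K) : regular K ->
  A #< [set: K] -> exists b, forall x, A x -> x < b.
Proof.
move=> Kreg /negP AK; have /existsNP [b nb] : ~ unbounded A by move=> /Kreg.
exists b => x Ax; rewrite ltNge; apply/negP => bx; apply: nb; by exists x.
Qed.

(** * Sets of size at most K *)

(** This replaces the condition of having at most K elements, to which it is equivalent by
    [homogeneous_card_le] and [card_le_homogeneous]. Its closure under products and unions needs no
    cardinal arithmetic. *)
Definition homogeneous {T} (D : set (set T)) {U} (A : set U) : Prop :=
  forall X (f : T -> U), D X -> (forall t, X t -> A (f t)) ->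
    exists Y u, [/\ D Y, Y `<=` X & forall t, Y t -> f t = u].

Section Homogeneous.
Context {d : Order.disp_t} {K : orderType d} {T : Type} {D : set (set T)}.
Context (Kcard : infinite_cardinal K) (Dbase : deciding_base K D).

Lemma base_nonempty X : D X -> X !=set0.
Proof. by case: Dbase => _ D2 _ _ /D2 [t [u [Xt _ _]]]; exists t. Qed.

Lemma base_other X t : D X -> exists2 u, X u & u <> t.
Proof.
case: Dbase => _ D2 _ _ /D2 [u [v [Xu Xv uv]]].
have [ut|ut] := pselect (u = t); last by exists u.
by exists v => // vt; apply: uv; rewrite ut vt.
Qed.

Lemma homogeneous_card_le {U} (A : set U) : A #<= [set: K] -> homogeneous D A.
Proof.
have [Kwo Kinf _] := Kcard; have [k0 _] := infinite_setN0 Kinf.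
move=> /card_le_surj [->|[g ->]] X f DX fA.
  by have [t /fA] := base_nonempty DX.
have /choice [h hP] : forall t, exists k, X t -> g k = f t.
  move=> t; have [/fA [k _ gk]|nX] := pselect (X t); first by exists k.
  by exists k0.
have [_ _ D3 _] := Dbase; have [Y [k [DY YX Yk]]] := D3 X h DX.
by exists Y, (g k); split=> // t Yt; rewrite -hP ?Yk //; exact: YX.
Qed.

Lemma homogeneous_bool : homogeneous D [set: bool].
Proof.
have [Kwo Kinf _] := Kcard; have [k0 _] := infinite_setN0 Kinf.
have [k1 k01] := infinite_cardinal_no_max Kcard k0.
apply: homogeneous_card_le.
apply: (inj_in_card_le (f := fun b : bool => if b then k0 else k1)) =>
  // x y _ _.
by case: x; case: y => // e; move: k01; rewrite e ltxx.
Qed.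

Lemma homogeneous_sub {U} (A B : set U) :
  A `<=` B -> homogeneous D B -> homogeneous D A.
Proof. by move=> AB Bh X f DX fA; apply: Bh DX _ => t /fA /AB. Qed.

Lemma homogeneous_bigcup {J U} (B : set J) (F : J -> set U) :
  homogeneous D B -> (forall j, B j -> homogeneous D (F j)) ->
  homogeneous D (\bigcup_(j in B) F j).
Proof.
move=> Bh Fh X f DX fF; have [t0 Xt0] := base_nonempty DX.
have [j0 _ _] := fF t0 Xt0.
have /choice [h hP] : forall t, exists j, X t -> B j /\ F j (f t).
  move=> t; have [/fF [j Bj Fj]|nX] := pselect (X t); first by exists j.
  by exists j0.
have [t Xt|Y [j [DY YX Yj]]] := Bh X h DX; first by case: (hP t Xt).
have [t Yt] := base_nonempty DY.
have [Bj _] := hP t (YX _ Yt); rewrite (Yj _ Yt) in Bj.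
have [s Ys|Z [u [DZ ZY Zu]]] := Fh j Bj Y f DY.
  by have [_] := hP s (YX _ Ys); rewrite (Yj _ Ys).
by exists Z, u; split=> //; exact: subset_trans ZY YX.
Qed.

Lemma homogeneous_setX {U V} (A : set U) (B : set V) :
  homogeneous D A -> homogeneous D B -> homogeneous D (A `*` B).
Proof.
move=> Ah Bh X f DX fAB.
have [t /fAB []//|Y [u [DY YX Yu]]] := Ah X (fun t => (f t).1) DX.
have [t /YX /fAB []//|Z [v [DZ ZY Zv]]] := Bh Y (fun t => (f t).2) DY.
exists Z, (u, v); split=> //; first exact: subset_trans ZY YX.
by move=> t Zt; rewrite [f t]surjective_pairing Yu ?Zv //; exact: ZY.
Qed.

Lemma homogeneous_family {I U} (V : set I) (f : T -> I -> U) X :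
  V #< [set: K] -> homogeneous D [set: U] -> D X ->
  exists Y, [/\ D Y, Y `<=` X &
    forall i, V i -> exists u, forall t, Y t -> f t i = u].
Proof.
have [Kwo _ _] := Kcard; have [_ _ _ Dcl] := Dbase => VK Uh.
apply: (base_fusion Kwo Dcl
  (P := fun i Y => exists u, forall t, Y t -> f t i = u)) => //.
- by move=> i Y Z _ ZY [u Yu]; exists u => t /ZY /Yu.
- move=> i Y _ DY; have [//|Z [u [DZ ZY Zu]]] := Uh Y (fun t => f t i) DY.
  by exists Z; split=> //; exists u.
Qed.

(* As free variables are bounded, these represent all valuations. *)
Definition bounded_valuation (z : K) : set (K -> K) :=
  [set a | exists b, forall i, b <= i -> a i = z].

(** This takes the place of $\kappa^{<\kappa}=\kappa$. First the bound is decided, then the fewer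
    than K values below it. *)
Lemma homogeneous_bounded_valuation z : homogeneous D (bounded_valuation z).
Proof.
have [Kwo Kinf Kini] := Kcard.
move=> X f DX fV.
have /choice [h hP] : forall t, exists b, X t -> forall i, b <= i -> f t i = z.
  move=> t; have [/fV [b bP]|nX] := pselect (X t); first by exists b.
  by exists z.
have [_ _ D3 _] := Dbase; have [Y [b [DY YX Yb]]] := D3 X h DX.
have Kh : homogeneous D [set: K] by exact: homogeneous_card_le.
have [Z [DZ ZY Zu]] := homogeneous_family f (Kini b) Kh DY.
have [t0 Zt0] := base_nonempty DZ.
exists Z, (f t0); split=> //; first exact: subset_trans ZY YX.
move=> t Zt; apply: funext => i; have [ib|bi] := ltP i b.
  by have [u Zi] := Zu i ib; rewrite !Zi.
have Zz t' : Z t' -> f t' i = z.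
  by move=> /ZY Yt'; apply: hP; [exact: YX|rewrite Yb].
by rewrite !Zz.
Qed.

End Homogeneous.

(** Otherwise [Kp] injects into A; but the injection would be constant on a member of D, which has
    two points. *)
Lemma card_le_homogeneous {d d'} {K : orderType d} {Kp : orderType d'}
    {D : set (set Kp)} :
  successor_cardinal K Kp -> deciding_base K D ->
  forall {U} (A : set U), homogeneous D A -> A #<= [set: K].
Proof.
move=> [[Kpwo _ _] _ Kp_le] Dbase U A Ah.
have [/card_le_injT [f fA finj]|[a Aa]] := card_le_wo Kpwo A; last first.
  exact: card_le_trans Aa (Kp_le a).
have [[X DX] D2 _ _] := Dbase.
have [Y [u [DY _ Yu]]] := Ah X f DX (fun t _ => fA t).
have [t [t' [Yt Yt' tt']]] := D2 Y DY; case: tt'; apply: finj.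
by rewrite !Yu.
Qed.

(** * Guessing pairs of branches *)

Section Guessing.
Context {d : Order.disp_t} {K : orderType d}.
Context (Kcard : infinite_cardinal K) (Kreg : regular K).

Lemma finite_card_lt {U} (A : set U) : finite_set A -> A #< [set: K].
Proof.
have [_ Kinf _] := Kcard.
by move=> Afin; apply/negP => /card_le_finite /(_ Afin).
Qed.

(** In a countable K no element is a limit, so every unbounded set is club. Each set is then guessed
    correctly at all late stages, which is absurd for two sets that differ early. *)
Lemma diamond_uncountable : diamond K -> [set: nat] #< [set: K].
Proof.
have [Kwo Kinf Kini] := Kcard.
move=> [A [Aini Ast]]; apply/negP => Knat.
have club_unb (C : set K) : unbounded C -> club C.
  move=> Cunb; split=> // l [a al] lC; exfalso.
  have /choice [g gP] : forall c : K, exists c', c < l -> c < c' < l.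
    move=> c; have [cl|_] := boolP (c < l); last by exists c.
    by have [c' _ ?] := lC c cl; exists c'.
  pose s n := iter n g a.
  have sl n : s n < l by elim: n => //= n IH; case/andP: (gP _ IH).
  have sm m n : (m < n)%N -> s m < s n.
    elim: n => // n IH; rewrite ltnS leq_eqVlt => /predU1P [->|/IH mn].
      by case/andP: (gP _ (sl n)).
    by apply: lt_trans mn _; case/andP: (gP _ (sl n)).
  have /negP := Kini l; apply; apply: card_le_trans Knat _.
  apply: (inj_in_card_le (f := s)) => [n _|m n _ _ smn]; first exact: sl.
  by case: (ltngtP m n) => // /sm; rewrite smn ltxx.
(* As limits do not occur, a guess that fails cofinally often fails on a
   club. *)
have late X : exists b, forall a, b <= a -> X `&` [set i | i < a] = A a.
  apply: contrapT => /forallNP nX.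
  have /club_unb /(Ast X) [a [/= ? ?]//] :
      unbounded [set a | X `&` [set i | i < a] <> A a].
  by move=> b; have /existsNP [a /not_implyP [ba na]] := nX b; exists a.
have [z _ zmin] := Kwo _ (infinite_setN0 Kinf).
have [b0 b0P] := late set0; have [b1 b1P] := late [set z].
have [c bc] := infinite_cardinal_no_max Kcard (Order.max b0 b1).
have zc : z < c by apply: le_lt_trans (zmin _ _) bc.
move: bc; rewrite gt_max => /andP [/ltW /b0P A0 /ltW /b1P A1].
have : set0 `&` [set i | i < c] = [set z] `&` [set i | i < c] by rewrite A0 A1.
by move=> /seteqP [_ /(_ z)] /= -[].
Qed.

(** Above any point, the supremum of countably many steps of [g] is closed under f; it exists
    because K is regular and uncountable. *)
Lemma club_closed_under (f : K -> bool -> K) (a : K) : [set: nat] #< [set: K] ->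
  club [set l | a <= l /\ forall i b, i < l -> f i b < l].
Proof.
have [Kwo Kinf Kini] := Kcard.
move=> Kunc; have [s lt_s lt_sE] := infinite_cardinal_succ Kcard.
have imb b c : exists m, forall i, i <= c -> f i b < m.
  have [|m mP] := @regular_bounded _ K ((f^~ b) @` [set i | i < s c]) Kreg.
    exact: card_le_lt_trans (card_image_le _ _) (Kini _).
  by exists m => i ic; apply: mP; exists i => //=; rewrite lt_sE.
have /choice [g gP] : forall c, exists m, c < m /\
    forall i b, i <= c -> f i b < m.
  move=> c; have [m mP] := imb true c; have [m' m'P] := imb false c.
  exists (Order.max (s c) (Order.max m m')); rewrite !lt_max lt_s;
    split=> // i b ic.
  by rewrite !lt_max; case: b; rewrite ?mP ?m'P ?orbT.
split=> [c|l [x xl] lC]; last first.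
  have al : a <= l.
    by have [c [ac _] /andP [_ /ltW]] := lC x xl; exact: le_trans.
  split=> // i b il; have [c [_ cP] /andP [ic cl]] := lC i il.
  by apply: lt_trans (cP i b ic) cl.
pose u n := iter n g (Order.max a c).
have [|m mP] := @regular_bounded _ K (range u) Kreg.
  exact: card_le_lt_trans (card_image_le _ _) Kunc.
have [|l [lu lmin]] := @wo_lub _ _ Kwo (range u) m; first by move=> x /mP /ltW.
have ul n : u n < l.
  by apply: lt_le_trans (lu _ (imageP _ (I : setT n.+1))); case: (gP (u n)).
exists l; last by apply: le_trans (ltW (ul 0%N));
  rewrite /u /= le_max lexx orbT.
split; first by apply: le_trans (ltW (ul 0%N)); rewrite /u /= le_max lexx.
move=> i b il; have [n iun] : exists n, i <= u n.
  apply: contrapT => /forallNP nu; move: il; rewrite ltNge => /negP; apply.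
  apply: lmin => _ [n _ <-]; apply: ltW; rewrite ltNge; exact/negP/nu.
apply: lt_trans (ul n.+1); rewrite /u /=; by case: (gP (u n)) => _; exact.
Qed.

End Guessing.

Section GuessingPairs.
Context {d : Order.disp_t} {K : orderType d}.
Context (Kcard : infinite_cardinal K) (Kreg : regular K).
Context (Kguess : diamond K \/ inaccessible K).

Lemma guessing_uncountable : [set: nat] #< [set: K].
Proof. by case: Kguess => [/(diamond_uncountable Kcard)|[]]. Qed.

Lemma guessing_sets : exists G : K -> set (set K),
  (forall a, G a #< [set: K]) /\
  forall X : set K, stationary [set a | G a (X `&` [set i | i < a])].
Proof.
case: Kguess => [[A [_ Ast]]|[_ _ Klim]].
  exists (fun a => [set A a]); split; last exact: Ast.
  by move=> a; apply: finite_card_lt => //; exact: finite_set1.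
have [_ Kinf Kini] := Kcard.
exists (fun a => [set X | X `<=` [set i | i < a]]); split.
  by move=> a; apply: Klim; exact: Kini.
move=> X C [Cunb _]; have [k _] := infinite_setN0 Kinf.
by have [c Cc _] := Cunb k; exists c; split=> // i [].
Qed.

(** A pair of branches is coded as one set through an injection of K * bool into K. At a closure
    point of the injection, the initial segment of the code determines those of both branches. *)
Lemma guessing_pairs : [set: K * bool] #<= [set: K] ->
  exists G : K -> set ((K -> bool) * (K -> bool)),
  (forall a, G a #< [set: K]) /\
  forall x y (a : K), exists l p, [/\ a <= l, G l p,
    forall i, i < l -> p.1 i = x i & forall i, i < l -> p.2 i = y i].
Proof.
move=> /card_le_injT [f _ finj].
have [G [GK Gst]] := guessing_sets.
pose dec (Z : set K) (b : bool) (i : K) := `[< Z (f (i, b)) >].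
exists (fun a => (fun Z => (dec Z true, dec Z false)) @` G a); split.
  by move=> a; exact: card_le_lt_trans (card_image_le _ _) (GK a).
move=> x y a.
pose Z : set K := [set k | exists i b, k = f (i, b) /\ if b then x i else y i].
have [l [Gl [al lC]]] := Gst Z _
  (club_closed_under Kcard Kreg (fun i b => f (i, b)) a guessing_uncountable).
have decE i b : i < l -> dec (Z `&` [set j | j < l]) b i = if b then x i else y
  i.
  move=> il; apply/asboolP/idP => [[[j [c [/finj [-> ->]]]]]//|xi].
  by split; [exists i, b|exact: lC].
exists l, (dec (Z `&` [set j | j < l]) true, dec (Z `&` [set j | j < l]) false).
split=> //=; first by exists (Z `&` [set j | j < l]).
  by move=> i; exact: (decE i true).
by move=> i; exact: (decE i false).
Qed.

End GuessingPairs.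

(** * Substitution and limit models *)

Section Semantics.
Context {K : Type} {L : vocabulary}.
Implicit Types (phi chi : fml K L) (M : Mod K L) (a b : K -> K).

Lemma sat_fv_imp phi M a b : (forall i, fv phi i -> a i = b i) ->
  sat M a phi -> sat M b phi.
Proof.
elim: phi a b => [i j|R t|phi IH|J Phi IH|J Phi IH|V phi IH|V phi IH] a b ab /=.
- by rewrite !ab //=; [right|left].
- rewrite (_ : map_tuple b t = map_tuple a t) //; apply: eq_from_tnth => k.
  by rewrite !tnth_map ab //; exists k.
- by move=> na /(IH b a) sa; apply: na; apply: sa => i /ab.
- by move=> sa k; apply: IH (sa k) => i ki; apply: ab; exists k.
- by move=> [k sa]; exists k; apply: IH sa => i ki; apply: ab; exists k.
- move=> [c [ca sc]]; exists (fun i => if pselect (V i) then c i else b i);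
    split.
    by move=> i Vi; case: pselect.
  apply: IH sc => i fi; case: pselect => // Vi; by rewrite ca // ab //; split.
- move=> sa c cb; pose c' i := if pselect (V i) then c i else a i.
  have /sa sc' : forall i, ~ V i -> c' i = a i by rewrite /c' => i;
    case: pselect.
  apply: IH sc' => i fi; rewrite /c'; case: pselect => // Vi.
  by rewrite cb // ab //; split.
Qed.

Lemma sat_fv phi M a b : (forall i, fv phi i -> a i = b i) ->
  sat M a phi <-> sat M b phi.
Proof. by move=> ab; split; apply: sat_fv_imp => i /ab. Qed.

(** The back-and-forth for a quantifier whose block V is renamed to V' by g; X is meant to be the
    set of free variables of the formula under the quantifier. *)
Lemma rename_valuations (X V V' : set K) (g h a : K -> K) :
  (forall i, (X `\` V) i -> g i = h i) -> set_bij V V' g ->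
  (forall i, (X `\` V) i -> ~ V' (g i)) ->
  (forall b, (forall j, ~ V' j -> b j = a j) ->
    exists2 c, forall i, ~ V i -> c i = a (h i) & forall i, X i ->
      c i = b (g i)) /\
  (forall c, (forall i, ~ V i -> c i = a (h i)) ->
    exists2 b, forall j, ~ V' j -> b j = a j & forall i, X i -> c i = b (g i)).
Proof.
move=> gh [gV ginj gsurj] gN; split=> [b ba|c ca].
  exists (fun i => if pselect (V i) then b (g i) else a (h i)).
    by move=> i; case: pselect.
  move=> i Xi; case: pselect => // Vi; have XVi : (X `\` V) i by split.
  by rewrite ba; [rewrite gh|exact: gN].
have /choice [f fP] : forall j, exists i, V' j -> V i /\ g i = j.
  move=> j; have [/gsurj [i Vi gi]|nV] := pselect (V' j); first by exists i.
  by exists j.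
exists (fun j => if pselect (V' j) then c (f j) else a j).
  by move=> j; case: pselect.
move=> i Xi; case: pselect => Vgi /=.
  have Vi : V i by apply: contrapT => nVi; exact: gN Vgi.
  congr c; have [Vf gf] := fP _ Vgi.
  by apply: ginj => //; exact: mem_set.
have nVi : ~ V i by move=> /gV.
by rewrite ca // gh.
Qed.

Lemma sat_subst phi phi' h M a : is_subst h phi phi' ->
  sat M a phi' <-> sat M (a \o h) phi.
Proof.
elim: phi phi' h a => [i j|R t|phi IH|J Phi IH|J Phi IH|V phi IH|V phi IH]
  phi' h a /=.
- by move=> ->.
- move=> -> /=; rewrite (_ : map_tuple a (map_tuple h t) = map_tuple (a \o h)
    t) //.
  by apply: eq_from_tnth => k; rewrite !tnth_map.
- by move=> [chi -> /IH /= ->].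
- move=> [J' [Psi [-> PhiPsi PsiPhi]]] /=; split=> sP k.
    by have [l /IH <-] := PhiPsi k.
  by have [l /IH ->] := PsiPhi k.
- move=> [J' [Psi [-> PhiPsi PsiPhi]]] /=; split=> -[k sk].
    by have [l /IH kl] := PsiPhi k; exists l; apply/kl.
  by have [l /IH kl] := PhiPsi k; exists l; apply/kl.
- move=> [V' [chi [g [-> [gh gbij gN] /IH sg]]]] /=.
  have [toV toV'] := rename_valuations a gh gbij gN; split.
    move=> [b [ba /sg sb]]; have [c ca cb] := toV b ba; exists c; split=> //.
    by apply: sat_fv_imp sb => i /cb.
  move=> [c [ca sc]]; have [b ba cb] := toV' c ca; exists b; split=> //.
  by apply/sg; apply: sat_fv_imp sc => i /cb.
- move=> [V' [chi [g [-> [gh gbij gN] /IH sg]]]] /=.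
  have [toV toV'] := rename_valuations a gh gbij gN; split=> sa.
    move=> c /toV' [b /sa /sg sb cb]; apply: sat_fv_imp sb => i /cb.
    by move=> ->.
  by move=> b /toV [c /sa sc cb]; apply/sg; apply: sat_fv_imp sc => i /cb.
Qed.

Lemma subformula_refl phi : subformula phi phi.
Proof. by case: phi => *; left. Qed.

Lemma in_logic_fv (mu : Type) phi : in_logic mu phi -> fv phi #< [set: mu].
Proof. by case: phi => [i j|R t|phi|J Phi|J Phi|V phi|V phi] []. Qed.

Context {T : Type}.
Implicit Types (N : T -> Mod K L) (X Y : set T).

(* A common witness is required besides a common truth value: it makes the
   truth value persist in the limit model. *)
Definition decides N X chi a : Prop :=
  match chi with
  | And J Phi => (forall t, X t -> sat (N t) a (And Phi)) \/
      exists k, forall t, X t -> ~ sat (N t) a (Phi k)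
  | Or J Phi => (forall t, X t -> ~ sat (N t) a (Or Phi)) \/
      exists k, forall t, X t -> sat (N t) a (Phi k)
  | Ex V phi => (forall t, X t -> ~ sat (N t) a (Ex V phi)) \/
      exists2 b, forall i, ~ V i -> b i = a i & forall t, X t -> sat (N t) b phi
  | All V phi => (forall t, X t -> sat (N t) a (All V phi)) \/
      exists2 b, forall i, ~ V i -> b i = a i & forall t, X t ->
        ~ sat (N t) b phi
  | _ => (forall t, X t -> sat (N t) a chi) \/ (forall t, X t ->
    ~ sat (N t) a chi)
  end.

Lemma decides_sub N X Y chi a : Y `<=` X -> decides N X chi a ->
  decides N Y chi a.
Proof.
move=> YX; case: chi => [i j|R s|phi|J Phi|J Phi|V phi|V phi] /= [XP|XP];
  try by left=> t /YX /XP.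
- by right=> t /YX /XP.
- by right=> t /YX /XP.
- by right=> t /YX /XP.
- by right; case: XP => k XP; exists k => t /YX /XP.
- by right; case: XP => k XP; exists k => t /YX /XP.
- by right; case: XP => b ba XP; exists b => // t /YX /XP.
- by right; case: XP => b ba XP; exists b => // t /YX /XP.
Qed.

End Semantics.

(** * Truth in limit models *)

Section Limit.
Context {d : Order.disp_t} {K : orderType d} {L : vocabulary} {T : Type}.
Context (N : T -> Mod K L) (V : K -> set T).

Definition limit_model : Mod K L :=
  fun R s => exists l, forall t, V l t -> @N t R s.

Context (V_anti : forall i j, i <= j -> V j `<=` V i)
  (V_ne : forall i, V i !=set0).

Lemma eventually_absurd (P : T -> Prop) :
  (exists l, forall t, V l t -> P t) -> (exists l, forall t, V l t ->
    ~ P t) -> False.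
Proof.
move=> [l lP] [m mP]; have [t Vt] := V_ne (Order.max l m).
by apply: (mP t); [|apply: (lP t)]; apply: V_anti Vt; rewrite le_max lexx ?orbT.
Qed.

Context (Kreg : regular K).

Lemma bounded_valuation_fv (z : K) (phi : fml K L) a : in_logic K phi ->
  exists2 b, bounded_valuation z b & forall i, fv phi i -> a i = b i.
Proof.
move=> /in_logic_fv /(regular_bounded Kreg) [c cP].
exists (fun i => if i < c then a i else z); last by move=> i /cP ->.
by exists c => i ci; rewrite ltNge ci.
Qed.

(** Only bounded valuations can be listed in K steps. By regularity, any valuation agrees with a
    bounded one on the free variables. *)
Lemma sat_limit_model_bounded (z : K) (phi : fml K L) : in_logic K phi ->
  (forall a, bounded_valuation z a ->
    sat limit_model a phi <-> exists l, forall t, V l t -> sat (N t) a phi) ->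
  forall a, sat limit_model a phi <-> exists l, forall t, V l t ->
    sat (N t) a phi.
Proof.
move=> phiK IH a; have [b /IH [bl lb] ab] := bounded_valuation_fv z a phiK.
have ba i : fv phi i -> b i = a i by move=> /ab.
split=> [/(sat_fv_imp ab) /bl [l lP]|[l lP]].
  by exists l => t /lP; exact: sat_fv_imp.
by apply: (sat_fv_imp ba); apply: lb; exists l => t /lP; exact: sat_fv_imp.
Qed.

(** The analogue of the truth lemma of forcing. Each goal is reduced to bounded valuations, where
    [dec] applies, while the induction hypothesis keeps all valuations, as the quantifiers
    require. *)
Lemma sat_limit_model (z : K) (phi : fml K L) : in_logic K phi ->
  (forall chi, subformula chi phi -> forall a, bounded_valuation z a ->
    exists l, decides N (V l) chi a) ->
  forall a, sat limit_model a phi <-> exists l, forall t, V l t ->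
    sat (N t) a phi.
Proof.
elim: phi => [i j|R s|phi IH|J Phi IH|J Phi IH|U phi IH|U phi IH] phiK dec;
  apply: (sat_limit_model_bounded (z := z)) => // a az.
(* An equation does not depend on the model; [a i] merely names some stage. *)
- split=> [/= aij|[l lP]]; first by exists (a i).
  by have [t /lP] := V_ne l.
- have {}IH := IH phiK.2 (fun chi s => dec chi (or_intror s)) a.
  have [l [lP|lP]] := dec _ (subformula_refl _) a az.
    split=> [_|[m mP] /IH aP]; first by exists l.
    by apply: (eventually_absurd aP); exists m.
  split=> [nP|lN]; last by case: (eventually_absurd lN); exists l.
  by case: nP; apply/IH; exists l => t /lP /= /contrapT.
- have {}IH k := IH k (phiK.2 k) (fun chi s =>
    dec chi (or_intror (ex_intro _ k s))).
  split=> [sP|[l lP] k]; last by apply/IH; exists l => t /lP.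
  have [l [lP|[k lP]]] := dec _ (subformula_refl _) a az; first by exists l.
  by have /IH kP := sP k; case: (eventually_absurd kP); exists l.
- have {}IH k := IH k (phiK.2 k) (fun chi s =>
    dec chi (or_intror (ex_intro _ k s))).
  split=> [[k /IH [l lP]]|lP]; first by exists l => t /lP; exists k.
  have [l [lN|[k kP]]] := dec _ (subformula_refl _) a az.
    by case: (eventually_absurd lP); exists l.
  by exists k; apply/IH; exists l.
- have {}IH := IH phiK.2.2 (fun chi s => dec chi (or_intror s)).
  split=> [[b [ba /IH [l lP]]]|lP]; first by exists l => t /lP; exists b.
  have [l [lN|[b ba bP]]] := dec _ (subformula_refl _) a az.
    by case: (eventually_absurd lP); exists l.
  by exists b; split=> //; apply/IH; exists l.
- have {}IH := IH phiK.2.2 (fun chi s => dec chi (or_intror s)).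
  split=> [sP|[l lP] b ba]; last by apply/IH; exists l => t /lP; exact.
  have [l [lP|[b ba bP]]] := dec _ (subformula_refl _) a az; first by exists l.
  by have /IH kP := sP b ba; case: (eventually_absurd kP); exists l.
Qed.

End Limit.

(** * Deciding formulas *)

Section Density.
Context {d : Order.disp_t} {K : orderType d} {T : Type} {D : set (set T)}.
Context (Kcard : infinite_cardinal K) (Dbase : deciding_base K D).
Context {L : vocabulary}.

Lemma base_agree (P : T -> Prop) X : D X -> exists Y, [/\ D Y, Y `<=` X &
  (forall t, Y t -> P t) \/ (forall t, Y t -> ~ P t)].
Proof.
move=> DX.
have [//|Y [b [DY YX Yb]]] := homogeneous_bool Kcard Dbase (f :=
  fun t => `[< P t >]) DX.
exists Y; split=> //; case: b Yb => Yb; [left|right] => t /Yb.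
  by move=> /asboolP.
by move=> /asboolPn.
Qed.

Lemma base_choose {U} (A : set U) (P : T -> U -> Prop) X :
  homogeneous D A -> D X -> (forall t, X t -> exists2 u, A u & P t u) ->
  exists Y u, [/\ D Y, Y `<=` X & forall t, Y t -> P t u].
Proof.
move=> Ah DX XP; have [t0 Xt0] := base_nonempty Dbase DX.
have [u0 _ _] := XP t0 Xt0.
have /choice [f fP] : forall t, exists u, X t -> A u /\ P t u.
  move=> t; have [/XP [u Au Pu]|nX] := pselect (X t); first by exists u.
  by exists u0.
have [t /fP []//|Y [u [DY YX Yu]]] := Ah X f DX.
exists Y, u; split=> // t Yt; rewrite -(Yu t Yt).
by have [] := fP t (YX t Yt).
Qed.

(** A witness is determined by its values on V, and these are few enough to be decided
    simultaneously. *)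
Lemma base_choose_valuation (V : set K) (a : K -> K) (P : T -> (K -> K) ->
  Prop) X :
  V #< [set: K] -> D X ->
  (forall t, X t -> exists b, (forall i, ~ V i -> b i = a i) /\ P t b) ->
  exists Y, [/\ D Y, Y `<=` X &
    exists2 b, forall i, ~ V i -> b i = a i & forall t, Y t -> P t b].
Proof.
move=> VK DX XP.
have /choice [f fP] : forall t, exists b,
    X t -> (forall i, ~ V i -> b i = a i) /\ P t b.
  move=> t; have [/XP [u Pu]|nX] := pselect (X t); first by exists u.
  by exists a.
have Kh := homogeneous_card_le Kcard Dbase (card_lexx [set: K]).
have [Y [DY YX Yu]] := homogeneous_family Kcard Dbase f VK Kh DX.
have [t0 Yt0] := base_nonempty Dbase DY.
exists Y; split=> //; exists (f t0); first by have [] := fP t0 (YX _ Yt0).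
move=> t Yt; have [ft Pt] := fP t (YX _ Yt); have [ft0 _] := fP t0 (YX _ Yt0).
rewrite (_ : f t0 = f t) //; apply: funext => i.
have [/Yu [u ui]|Vi] := pselect (V i); first by rewrite !ui.
by rewrite ft // ft0.
Qed.

Lemma base_decides (N : T -> Mod K L) (chi : fml K L) a X :
  in_logic K chi -> D X -> exists Y, [/\ D Y, Y `<=` X & decides N Y chi a].
Proof.
have hJ (J : set K) : homogeneous D [set: J].
  exact: homogeneous_card_le (set_type_card_le J).
move=> chiK DX; have [Y [DY YX YP]] := base_agree (fun t => sat (N t) a chi) DX.
case: chi chiK YP => [i j|R s|phi|J Phi|J Phi|V phi|V phi] chiK YP.
- by exists Y.
- by exists Y.
- by exists Y.
- case: YP => YP; first by exists Y; split=> //; left.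
  have [|Z [k [DZ ZY Zk]]] := base_choose (P :=
    fun t k => ~ sat (N t) a (Phi k)) (hJ J) DY.
    by move=> t /YP /= /existsNP [k nk]; exists k.
  by exists Z; split=> //; [exact: subset_trans ZY YX|right; exists k].
- case: YP => YP; last by exists Y; split=> //; left.
  have [|Z [k [DZ ZY Zk]]] := base_choose (P :=
    fun t k => sat (N t) a (Phi k)) (hJ J) DY.
    by move=> t /YP /= [k nk]; exists k.
  by exists Z; split=> //; [exact: subset_trans ZY YX|right; exists k].
- case: YP => YP; last by exists Y; split=> //; left.
  have [Z [DZ ZY Zb]] := base_choose_valuation chiK.2.1 DY YP.
  by exists Z; split=> //; [exact: subset_trans ZY YX|right].
- case: YP => YP; first by exists Y; split=> //; left.
  have [|Z [DZ ZY Zb]] := base_choose_valuation (a := a) (P :=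
    fun t b => ~ sat (N t) b phi)
    chiK.2.1 DY.
    by move=> t /YP /= /existsNP [b /not_implyP [ba nb]]; exists b.
  by exists Z; split=> //; [exact: subset_trans ZY YX|right].
Qed.

(** The counterpart of the count that a formula has at most K subformulas. *)
Lemma homogeneous_subformula (phi : fml K L) :
  homogeneous D [set chi | subformula chi phi].
Proof.
have h1 chi : homogeneous D [set chi : fml K L].
  by move=> X f DX fX; exists X, chi; split=> // t /fX.
have hU (A B : set (fml K L)) : homogeneous D A -> homogeneous D B ->
    homogeneous D (A `|` B).
  move=> Ah Bh; apply: (homogeneous_sub (B := \bigcup_b if b then A else B)).
    by move=> x [Ax|Bx]; [exists true|exists false].
  apply: (homogeneous_bigcup Dbase (homogeneous_bool Kcard Dbase)).
  by move=> [] _.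
have hJ (J : set K) (Phi : J -> fml K L) :
    (forall k, homogeneous D [set chi | subformula chi (Phi k)]) ->
    homogeneous D [set chi | exists k, subformula chi (Phi k)].
  move=> Ph; apply: (homogeneous_sub
    (B := \bigcup_(k in [set: J]) [set chi | subformula chi (Phi k)])).
    by move=> chi [k sk]; exists k.
  apply: (homogeneous_bigcup Dbase) => [|k _]; last exact: Ph.
  exact: homogeneous_card_le (set_type_card_le J).
have hF : homogeneous D [set _ : fml K L | False].
  move=> X f DX fX; have [t /fX //] := base_nonempty Dbase DX.
elim: phi => [i j|R s|phi IH|J Phi IH|J Phi IH|V phi IH|V phi IH].
- exact: (hU _ _ (h1 _) hF).
- exact: (hU _ _ (h1 _) hF).
- exact: (hU _ _ (h1 _) IH).
- exact: (hU _ _ (h1 _) (hJ _ _ IH)).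
- exact: (hU _ _ (h1 _) (hJ _ _ IH)).
- exact: (hU _ _ (h1 _) IH).
- exact: (hU _ _ (h1 _) IH).
Qed.

End Density.

Lemma subformula_in_logic (K : Type) (L : vocabulary) (mu : Type)
  (chi phi : fml K L) : subformula chi phi -> in_logic mu phi ->
    in_logic mu chi.
Proof.
elim: phi => [i j|R s|phi IH|J Phi IH|J Phi IH|V phi IH|V phi IH] [-> //|] //=.
- by move=> /IH sub [_ /sub].
- by move=> [k /IH sub] [_ /(_ k) /sub].
- by move=> [k /IH sub] [_ /(_ k) /sub].
- by move=> /IH sub [_ [_ /sub]].
- by move=> /IH sub [_ [_ /sub]].
Qed.

(** The tasks of deciding a formula under a bounded valuation are listed along K, so that level l of
    the tree can carry out the l-th one. *)
Lemma task_enumeration {d d'} {K : orderType d} {Kp : orderType d'}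
    {D : set (set Kp)} {L : vocabulary} (z : K) (A : set (fml K L)) :
  infinite_cardinal K -> successor_cardinal K Kp -> deciding_base K D ->
  homogeneous D A -> A !=set0 ->
  exists tau : K -> fml K L * (K -> K), (forall k, A (tau k).1) /\
    forall chi a, A chi -> bounded_valuation z a -> exists k, tau k = (chi, a).
Proof.
move=> Kcard Kps Dbase Ah [phi Aphi].
have := card_le_homogeneous Kps Dbase
  (homogeneous_setX Ah (homogeneous_bounded_valuation Kcard Dbase (z := z))).
case/card_le_surj => [/seteqP [/(_ (phi, fun=> z)) + _]|[tau tauE]].
  by case; split=> //; exists z.
exists tau; split=> [k|chi a Achi az].
  have /seteqP [_ sub] := tauE; by have [] := sub (tau k) (imageP _ I).
have /seteqP [sub _] := tauE; by have [k _ <-] := sub (chi, a) (conj Achi az);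
  exists k.
Qed.

(** * Closedness of embeddability *)

Section Compactness.
Context {d : Order.disp_t} {K : orderType d}.

Lemma kappa_compact_subcover {U : topologicalType} (B : set U) (O : U ->
  set U) :
  kappa_compact [set: K] B -> (forall h, B h -> open (O h) /\ O h h) ->
  exists C, [/\ C `<=` B, C #< [set: K] & forall h', B h' -> exists2 h, C h &
    O h h'].
Proof.
move=> Bc BO; have [||C [CO CK BC]] := Bc (O @` B).
- by move=> _ [h /BO [oO _] <-].
- by move=> h Bh; exists (O h); [exists h|have [] := BO h Bh].
have [h0|B0] := pselect (B !=set0); last first.
  exists set0; split=> // [|h Bh]; first exact: card_le_lt_trans (card_ge0 _ _)
    CK.
  by case: B0; exists h.
have /choice [c cP] : forall X, exists h, C X -> B h /\ O h = X.
  move=> X; have [/CO [h Bh hX]|nX] := pselect (C X); first by exists h.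
  by case: h0 => h _; exists h.
exists (c @` C); split.
- by move=> _ [X /cP [Bc' _] <-].
- exact: card_le_lt_trans (card_image_le _ _) CK.
- move=> h' /BC [X CX Xh']; exists (c X); first by exists X.
  by have [_ ->] := cP X CX.
Qed.

Lemma open_baire_nbhd (p : pfun K) : short_seq K p -> open (@baire_nbhd _ K p).
Proof.
move=> ps; exists [set @baire_nbhd _ K p]; last by rewrite bigcup_set1.
by move=> _ ->; exact: finI_from1.
Qed.

(** By regularity the coordinates in [X h] are bounded, so agreement with h on them follows from
    membership in a basic neighbourhood of h. *)
Lemma baire_compact_subcover (B : set (baire K)) (X : (K -> K) -> set K) :
  infinite_cardinal K -> regular K -> kappa_compact [set: K] B ->
    (forall h, B h -> X h #< [set: K]) ->
  exists C : set (K -> K), [/\ C `<=` B, C #< [set: K] &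
    forall h', B h' -> exists2 h, C h & forall i, X h i -> h' i = h i].
Proof.
move=> [_ Kinf _] Kreg Bc BX; have [z _] := infinite_setN0 Kinf.
have /choice [b bP] : forall h, exists b, B h -> forall i, X h i -> i < b.
  move=> h; have [/BX /(regular_bounded Kreg) [b bP]|nB] := pselect (B h).
    by exists b.
  by exists z.
have [h Bh|C [CB CK BC]] := kappa_compact_subcover
    (U := baire K) (O := fun h : baire K => @baire_nbhd _ K (restr h (b h))) Bc.
  split; last by move=> i x; rewrite /restr; case: ifP => // _ [<-].
  apply: open_baire_nbhd; exists (b h) => i; rewrite /restr; by case: ifP.
exists C; split=> // h' /BC [h Ch hh']; exists h => // i Xi.
have : restr h (b h) i = Some (h i) by rewrite /restr bP //; exact: CB.
by move=> /hh' [].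
Qed.

Lemma open_ptws_agree (h : {ptws K -> discrete_topology K}) (X : set K) :
  finite_set X ->
  open [set h' : {ptws K -> discrete_topology K} | forall i, X i -> h' i = h i].
Proof.
move=> /finite_fsetP [Y ->]; rewrite openE => g gh.
suff : nbhs g (\bigcap_(i in [set` Y])
    [set h' : {ptws K -> discrete_topology K} | h' i = h i]).
  by apply: filterS => h' h'Y i Yi; exact: h'Y.
apply: filter_bigI => i Yi.
have gi : nbhs (g i : discrete_topology K) [set h i].
  by rewrite (gh i Yi); exact: discrete_set1.
exact: (@proj_continuous K (fun=> discrete_topology K) i g _ gi).
Qed.

Lemma ptws_compact_subcover (B : set {ptws K -> discrete_topology K})
    (X : (K -> K) -> set K) :
  kappa_compact [set: K] B -> (forall h, B h -> finite_set (X h)) ->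
  exists C : set (K -> K), [/\ C `<=` B, C #< [set: K] &
    forall h', B h' -> exists2 h, C h & forall i, X h i -> h' i = h i].
Proof.
move=> Bc BX; apply: kappa_compact_subcover Bc _ => h /BX Xfin.
by split=> //; exact: open_ptws_agree.
Qed.

End Compactness.

(** * Embeddability by compact sets *)

Section Embeddings.
Context {d : Order.disp_t} {K : orderType d} {L : vocabulary}.
Implicit Types (F : set (fml K L)) (B : set (K -> K)) (M : Mod K L).

(* Embeddability by B is a closed relation: its failure is witnessed by a
   proper initial segment of an enumeration phi of the fragment. *)
Definition boundedly_refutable F (phi : K -> fml K L) B : Prop :=
  forall A A', ~ elem_embeddable F B A A' -> exists b, forall M M',
    (forall j, j < b -> sat A id (phi j) <-> sat M id (phi j)) ->
    (forall j, j < b -> sat A' id (phi j) <-> sat M' id (phi j)) ->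
    ~ elem_embeddable F B M M'.

(** Each h in B fails on some formula, and every g that agrees with h on its free variables fails
    there too. Fewer than K of these failures cover B, so by regularity their indices are
    bounded. *)
Lemma subcover_boundedly_refutable F (phi : K -> fml K L) B :
  infinite_cardinal K -> regular K -> fragment F ->
  (forall chi, F chi -> exists j, phi j = chi) ->
  (forall f : (K -> K) -> fml K L, (forall h, F (f h)) ->
    exists C : set (K -> K), [/\ C `<=` B, C #< [set: K] &
      forall h', B h' -> exists2 h, C h & forall i, fv (f h) i ->
        h' i = h i]) ->
  boundedly_refutable F phi B.
Proof.
move=> [_ Kinf _] Kreg [_ _ [FEq _] [_ _ Fsub]] Fphi Bcov A A' nAA'.
have [z _] := infinite_setN0 Kinf.
(* The first index is that of a formula on which h fails at [id]; the second is that of its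
   substitution by h, which turns truth at h in [A'] into truth at [id]. *)
have /choice [w wP] : forall h, exists w : K * K, [/\ F (phi w.1),
    is_subst h (phi w.1) (phi w.2) &
    B h -> ~ (sat A id (phi w.1) <-> sat A' h (phi w.1))].
  move=> h; suff [chi Fchi chiP] : exists2 chi, F chi &
      B h -> ~ (sat A id chi <-> sat A' h chi).
    have [chi' /Fphi [k <-] sub] := Fsub h chi Fchi.
    by have [j jE] := Fphi chi Fchi; exists (j, k); rewrite /= jE; split.
  (* Outside [B] any formula of the fragment will do. *)
  have [Bh|nB] := pselect (B h); last by exists (Equ z z).
  have /existsNP [chi /existsNP [a /not_implyP [Fchi nchi]]] : ~ forall chi a,
      F chi -> (sat A a chi <-> sat A' (h \o a) chi).
    by move=> hP; apply: nAA'; exists h.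
  (* Substituting along the valuation [a] moves the failure to the valuation [id]. *)
  have [chi' Fchi' sub] := Fsub a chi Fchi; exists chi' => // _.
  by rewrite (sat_subst A id sub) (sat_subst A' h sub).
have [|C [CB CK BC]] := Bcov (fun h => phi (w h).1).
  by move=> h; case: (wP h).
have [|b1 b1P] := regular_bounded (A := (fun h => (w h).1) @` C) Kreg.
  exact: card_le_lt_trans (card_image_le _ _) CK.
have [|b2 b2P] := regular_bounded (A := (fun h => (w h).2) @` C) Kreg.
  exact: card_le_lt_trans (card_image_le _ _) CK.
exists (Order.max b1 b2) => M M' AM AM' [g Bg gP].
have [h Ch gh] := BC g Bg; have [Fj sub /(_ (CB _ Ch))] := wP h; apply.
have jb : (w h).1 < Order.max b1 b2 by rewrite lt_max b1P //; exists h.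
have kb : (w h).2 < Order.max b1 b2 by rewrite lt_max b2P ?orbT //; exists h.
rewrite AM // (gP _ id Fj) (sat_fv M' (a := g \o id) (b := h) gh).
by rewrite -(sat_subst M' id sub) -(sat_subst A' id sub) AM'.
Qed.

Lemma K_kappa_boundedly_refutable F (phi : K -> fml K L) (H : set (K -> K)) :
  infinite_cardinal K -> regular K -> fragment F ->
  (forall chi, F chi -> exists j, phi j = chi) ->
  @K_kappa K [set: K] (baire K) H \/
    (@K_kappa K [set: K] {ptws K -> discrete_topology K} H /\
      F `<=` in_logic nat) ->
  exists B : K -> set (K -> K), (forall i, boundedly_refutable F phi (B i)) /\
    H = \bigcup_i B i.
Proof.
move=> Kcard Kreg Ffrag Fphi HK.
have [S [SK Sref ->]] : exists S : set (set (K -> K)), [/\ S #<= [set: K],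
    forall B, S B -> boundedly_refutable F phi B & H = \bigcup_(B in S) B].
  case: HK => [[S [SK Sc HS]]|[[S [SK Sc HS]] Fnat]]; exists S;
    split=> // B /Sc Bc;
    apply: subcover_boundedly_refutable => // f Ff.
  - apply: baire_compact_subcover => // h _.
    by case: Ffrag => Flog _ _ _; apply/in_logic_fv/Flog.
  - apply: ptws_compact_subcover => // h _.
    have /negP := in_logic_fv (Fnat _ (Ff h)).
    by move=> /finite_setPn.
have [->|[B SB]] := card_le_surj SK.
  exists (fun=> set0); split; last by rewrite bigcup_set0 bigcup0.
  move=> _ A A' _; have [_ Kinf _] := Kcard; have [z _] := infinite_setN0 Kinf.
  by exists z => M M' _ _ [].
exists B; split=> [i|]; last by rewrite SB bigcup_image.
by apply: Sref; rewrite SB; exists i.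
Qed.

End Embeddings.

(** * Perfect sets *)

Section PerfectRange.
Context {d : Order.disp_t} {K : orderType d}.
Context (Kcard : infinite_cardinal K) (Kreg : regular K).

(* z x is a branch through a tree coded by x, and J l x is the l-th splitting
   level along it. *)
Context (z : (K -> bool) -> K -> bool) (J : K -> (K -> bool) -> K).
Context
  (J_local : forall l x y, (forall i, i < l -> x i = y i) -> J l x = J l y)
  (J_ge : forall l x, l <= J l x)
  (z_local : forall l x y, (forall i, i < l -> x i = y i) ->
    forall j, j < J l x -> z x j = z y j)
  (z_J : forall l x, z x (J l x) = x l).

(* Following y through the tree, x l is the bit of y at the l-th splitting
   level. *)
Lemma descent y : exists x, forall a, (exists x', forall i, i < a ->
  z x' i = y i) ->
  forall i, i < a -> z x i = y i.
Proof.
have [Kwo _ _] := Kcard.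
have [||x xP] := @wo_dependent_choice _ _ Kwo bool (fun l x b =>
  b = y (J l x)) true.
- by move=> l f g b fg ->; rewrite (J_local fg).
- by move=> l f _; exists (y (J l f)).
exists x => a [x' x'y] i ia.
(* Below the first [l] whose splitting level reaches [a], the codes x and x' agree; so their
   branches agree up to [a]. *)
have [l la lmin] := Kwo [set l | a <= J l x'] (ex_intro _ a (J_ge a x')).
have xx' : forall k, k < l -> x' k = x k.
  apply: (wo_ind Kwo) => k IH kl.
  have ka : J k x' < a.
    by rewrite ltNge; apply/negP => /lmin; rewrite leNgt kl.
  rewrite xP -(@J_local k x' x); first by rewrite -x'y // z_J.
  by move=> m mk; apply: IH => //; exact: lt_trans kl.
by rewrite -(z_local xx') ?x'y //; exact: lt_le_trans la.
Qed.

(** The ordinals 0 and 1 are the least element of K and its successor. *)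
Lemma cantor_code : exists c : bool -> K, injective c /\
  forall (k : K) (b : bool), ([set j | j < k] #= `I_b) <-> k = c b.
Proof.
have [Kwo Kinf _] := Kcard; have [o _ omin] := Kwo _ (infinite_setN0 Kinf).
have [s lt_s lt_sE] := infinite_cardinal_succ Kcard.
have o0 : [set j | j < o] = set0.
  by apply/seteqP; split=> // j /=; rewrite ltNge omin.
have so1 : [set j | j < s o] = [set o].
  apply/seteqP; split=> j /=; last by move=> ->; exact: lt_s.
  by rewrite lt_sE => jo; apply/eqP; rewrite eq_le jo omin.
exists (fun b : bool => if b then s o else o); split.
  by move=> [] [] // e; have := lt_s o; [rewrite e|rewrite -e]; rewrite ltxx.
move=> k [] /=; split=> [|->].
- move=> k1; have /card_le_surj [k0|[f kf]] : [set j | j < k] #<= [set o].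
    by rewrite (card_le_eqr (card_set1 (x := o))); move: k1;
      rewrite card_eq_le => /andP [].
    by move: k1; rewrite k0 card_eq_sym -[@set0 _]/(@set0 K) card_eq0 =>
      /eqP /seteqP [/(_ 0%N)] /= /(_ isT).
  have {}kf : [set j | j < k] = [set f o] by rewrite kf image_set1.
  have ok : o < k.
    have : [set j | j < k] (f o) by rewrite kf.
    exact: le_lt_trans (omin _ I).
  have fo : o = f o by have : [set j | j < k] o by []; rewrite kf.
  apply/eqP; rewrite eq_le; apply/andP; split; rewrite leNgt; apply/negP;
    last by rewrite lt_sE leNgt ok.
  move=> sk; have : [set j | j < k] (s o) by []; rewrite kf -fo /= => so.
  by have := lt_s o; rewrite so ltxx.
- by rewrite so1 card_set1.
- rewrite II0 card_eq0 => /eqP k0; apply/eqP; rewrite eq_le omin // andbT leNgt.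
  by apply/negP => ok; have : [set j | j < k] o by []; rewrite k0.
- by rewrite o0 II0 card_eq0.
Qed.

Lemma restr_eq (x y : K -> K) a b : restr x a = restr y b ->
  a = b /\ forall i, i < a -> x i = y i.
Proof.
move=> xy; have ab : a = b.
  by case: (ltgtP a b) => // ab;
    [move: (congr1 (@^~ a) xy)|move: (congr1 (@^~ b) xy)];
      rewrite /restr ltxx ab.
split=> // i ia; move: (congr1 (@^~ i) xy).
by rewrite /restr -ab ia => -[].
Qed.

(** The tree consists of the initial segments of the coded branches. For its closure and for the
    absence of further branches, [descent] supplies one code that serves all given initial
    segments. *)
Lemma perfect_range : perfect_subset (cantor_in_baire (range z)).
Proof.
have [Kwo Kinf _] := Kcard.
have [s lt_s lt_sE] := infinite_cardinal_succ Kcard.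
have [c [cinj cP]] := cantor_code.
pose cz x i := c (z x i).
have YE : cantor_in_baire (range z) = range cz.
  apply/seteqP; split=> w.
    by move=> [_ [x _ <-] wP]; exists x => //; apply: funext => i;
      apply/esym/cP.
  by move=> [x _ <-]; exists (z x) => [|i]; [exists x|apply/cP].
exists [set p | exists x a, p = restr (cz x) a]; rewrite YE; split.
- split=> [_ [x [a ->]]|p q [b pb] pq [x [a qE]]].
    by exists a => i; rewrite /restr; case: ifP.
  exists x, b; apply: funext => i; have := pb i; rewrite /restr.
  case pi : (p i) => [v|] /= <- //; move: (pq _ _ pi).
  by rewrite qE /restr; case: ifP.
- move=> _ [x [a ->]]; set j := J a x.
  (* Flipping bit [a] of the code changes the branch at level [j] but not before. *)
  pose x' i := if i == a then ~~ x a else x i.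
  have xx' i : i < a -> x i = x' i by rewrite /x' => /lt_eqF ->.
  have zz' : forall i, i < j -> z x i = z x' i by exact: z_local xx'.
  have zj : z x' j = ~~ x a by rewrite /j (J_local xx') z_J /x' eqxx.
  have imm y : (forall i, i < j -> z x i = z y i) ->
      immediate_successor (restr (cz x) j) (restr (cz y) (s j)).
    move=> xy; exists j, (cz y j); split; first by move=> i; rewrite /restr;
      case: ifP.
    apply: funext => i; rewrite /restr lt_sE le_eqVlt; case: eqP => [->//|_] /=.
    by case: ifP => // ij; rewrite /cz xy.
  exists (restr (cz x) j); split; first by exists x, j.
    by move=> i v; rewrite /restr; case: ifP => // ia;
      rewrite (lt_le_trans ia (J_ge a x)).
  exists (restr (cz x) (s j)), (restr (cz x') (s j)); split.
  + by exists x, (s j).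
  + by exists x', (s j).
  + exact: imm.
  + exact: imm.
  + move=> /restr_eq [_ /(_ j (lt_s j)) /cinj]; rewrite zj /j z_J.
    by case: (x a).
- move=> a p pT pm.
  have /choice [w wP] : forall i, exists w : (K -> bool) * K,
      i < a -> p i = restr (cz w.1) w.2.
    move=> i; have [/pT [x [b ->]]|nia] := boolP (i < a);
      first by exists (x, b).
    by exists (fun=> true, i).
  have [|b bP] := regular_bounded (A := (fun i =>
    (w i).2) @` [set i | i < a]) Kreg.
    by apply: card_le_lt_trans (card_image_le _ _) _; case: Kcard => _ _; exact.
  (* The union of the sequences [p i], continued by [false]. *)
  pose y j := `[< exists2 i, i < a & p i j = Some (c true) >].
  have [x xy] := descent y.
  have wy i : i < a -> forall j, j < (w i).2 -> z (w i).1 j = y j.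
    move=> ia j jw.
    have pij : p i j = Some (cz (w i).1 j) by rewrite wP // /restr jw.
    apply/idP/asboolP => [zt|[i' ia' pi'j]]; first by exists i => //;
      rewrite pij /cz zt.
    have : p i j = p i' j.
      have [ii'|/ltW i'i] := leP i i'.
        by rewrite pij (pm i i' ii' ia' _ _ pij).
      by rewrite pi'j (pm i' i i'i ia _ _ pi'j).
    by rewrite pij pi'j => -[/cinj].
  exists (restr (cz x) b); first by exists x, b.
  move=> i ia j v; rewrite wP // /restr; case: ifP => // jw [<-].
  have jb : j < b by apply: lt_trans jw _; apply: bP; exists i.
  rewrite jb /cz wy // -(xy (w i).2) //.
  by exists (w i).1 => k; exact: wy.
- apply/seteqP; split=> [_ [x _ <-] a|w wT]; first by exists x, a.
  pose y i := `[< w i = c true >].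
  have wE a : exists x, forall i, i < a -> z x i = y i /\ w i = c (y i).
    have [x [b /restr_eq [_ wx]]] := wT a; exists x => i ia.
    suff zy : z x i = y i by split=> //; rewrite wx // /cz zy.
    apply/idP/asboolP => [zt|]; first by rewrite wx // /cz zt.
    by rewrite wx // => /cinj.
  have [x xy] := descent y; exists x => //; apply: funext => i.
  have [x' x'P] := wE (s i); have [_ ->] := x'P i (lt_s i).
  rewrite /cz (xy (s i)) //; exists x' => k ki.
  by have [] := x'P k ki.
Qed.

End PerfectRange.

(** * The tree *)

Section Tree.
Context {d : Order.disp_t} {K : orderType d} {T : Type} {D : set (set T)}.
Context (Kcard : infinite_cardinal K) (Dbase : deciding_base K D).

Context (bit : T -> K -> bool).
Context (bit_sep : forall t u, t <> u -> exists j, bit t j <> bit u j).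

(** Whatever depends on boundedly many bits of t can be imposed on a member of D below X. Avoiding
    t0 allows two such points to be chosen distinct. *)
Lemma approximable_point X t0 : D X -> exists t, [/\ X t, t <> t0 &
  forall b, exists Z, [/\ D Z, Z `<=` X & forall u i, Z u -> i < b ->
    bit u i = bit t i]].
Proof.
have [Kwo _ Kini] := Kcard; have [_ _ D3 _] := Dbase.
move=> DX; apply: contrapT => /forallNP nX.
have /choice [f fP] : forall t, exists b, X t -> t <> t0 -> ~ exists Z,
    [/\ D Z, Z `<=` X & forall u i, Z u -> i < b -> bit u i = bit t i].
  move=> t; have [[Xt tt0]|nt] := pselect (X t /\ t <> t0).
    have /existsNP [b nb] : ~ forall b, exists Z,
        [/\ D Z, Z `<=` X & forall u i, Z u -> i < b -> bit u i = bit t i].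
      by move=> aP; apply: (nX t).
    by exists b.
  have [_ Kinf _] := Kcard; have [b _] := infinite_setN0 Kinf.
  by exists b => Xt tt0; case: nt.
(* If every point t fails at some length f t, then f is constant on some Y in
   D, and a Z below Y that decides that many bits approximates its own
   points. *)
have [Y [b [DY YX Yb]]] := D3 X f DX.
have [Z [DZ ZY Zb]] := homogeneous_family Kcard Dbase bit (Kini b)
  (homogeneous_bool Kcard Dbase) DY.
have [t Zt tt0] := base_other Dbase t0 DZ.
apply: (fP t) => //; first by apply: YX; exact: ZY.
rewrite (Yb t (ZY _ Zt)); exists Z; split=> //; first exact: subset_trans ZY YX.
by move=> u i Zu ib; have [v Zv] := Zb i ib; rewrite !Zv.
Qed.

(** Take two distinct approximable points and let j be the first bit at which they differ. Each half
    approximates one of them. *)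
Lemma splitting_node X : D X -> exists (j : K) (Z : bool -> set T), [/\
  forall b, D (Z b), forall b, Z b `<=` X,
  forall b t, Z b t -> bit t j = b &
  forall b b' t u i, Z b t -> Z b' u -> i < j -> bit t i = bit u i].
Proof.
have [Kwo _ Kini] := Kcard.
have [s lt_s lt_sE] := infinite_cardinal_succ Kcard.
move=> DX; have [a0 _] := base_nonempty Dbase DX.
have [t [Xt _ tP]] := approximable_point a0 DX.
have [u [Xu ut uP]] := approximable_point t DX.
have [j tuj jmin] := Kwo _ (bit_sep ut).
have tu i : i < j -> bit t i = bit u i.
  move=> ij; apply: contrapT => /eqP; rewrite eq_sym => /eqP /jmin.
  by rewrite leNgt ij.
(* The length is [s j], so that bit [j] itself is included. *)
have [Zt [DZt ZtX Ztt]] := tP (s j); have [Zu [DZu ZuX Zuu]] := uP (s j).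
exists j, (fun b => if b == bit t j then Zt else Zu).
have lej i : i < j -> i < s j by rewrite lt_sE => /ltW.
split=> [b|b|b v|b b' v w i]; try by case: ifP.
- case: ifP => [/eqP -> /Ztt -> //|/negbT bt /Zuu -> //].
  by move: bt tuj; case: b; case: (bit t j); case: (bit u j).
- have vt x (c : bool) : (if c then Zt else Zu) x -> i < j -> bit x i = bit t i.
    by case: c => xZ ij; [rewrite (Ztt _ _ xZ (lej _ ij))|
      rewrite (Zuu _ _ xZ (lej _ ij)) tu].
  by move=> vZ wZ ij; rewrite (vt _ _ vZ) // (vt _ _ wZ).
Qed.

Context (Dec : K -> set T -> Prop) (Ref : K -> set T -> set T -> Prop).
Context
  (Dec_sub : forall i X Y, Y `<=` X -> Dec i X -> Dec i Y)
  (Dec_dense : forall i X, D X -> exists Y, [/\ D Y, Y `<=` X & Dec i Y])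
  (Ref_sub : forall i X Y X' Y', X' `<=` X -> Y' `<=` Y -> Ref i X Y ->
    Ref i X' Y')
  (Ref_dense : forall i X Y, D X -> D Y -> exists X' Y',
    [/\ D X', D Y', X' `<=` X, Y' `<=` Y & Ref i X' Y']).

Context (G : K -> set ((K -> bool) * (K -> bool))).
Context (G_lt : forall l, G l #< [set: K])
  (G_guess : forall x y (a : K), exists l p, [/\ a <= l, G l p,
    forall i, i < l -> p.1 i = x i & forall i, i < l -> p.2 i = y i]).

(** A node of level l is represented by the branch that continues it with [false], so that all
    levels are indexed by the same type. *)
Definition cut (l : K) (x : K -> bool) : K -> bool := fun i => (i < l) && x i.

Lemma cut_lt l x i : i < l -> cut l x i = x i.
Proof. by rewrite /cut => ->. Qed.

Lemma cut_cut i l x : i <= l -> cut i (cut l x) = cut i x.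
Proof.
move=> il; apply: funext => j; rewrite /cut andbA; case: ltP => //= ji.
by rewrite (lt_le_trans ji il).
Qed.

Lemma cut_eq l x y : (forall i, i < l -> x i = y i) -> cut l x = cut l y.
Proof.
by move=> xy; apply: funext => i; rewrite /cut; case: ltP => //= /xy.
Qed.

(* The pairs are treated one after the other in the product over all nodes of
   the level; this is possible because there are fewer than K of them. *)
Lemma level_refine (l : K) (Z : (K -> bool) -> set T) : (forall x, D (Z x)) ->
  exists Z', [/\ forall x, D (Z' x), forall x, Z' x `<=` Z x,
    forall x, Dec l (Z' x) &
    forall p, G l p -> cut l p.1 <> cut l p.2 ->
      forall i, i < l -> Ref i (Z' (cut l p.1)) (Z' (cut l p.2))].
Proof.
have [Kwo _ Kini] := Kcard; have [_ _ _ Dcl] := Dbase => DZ.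
have /choice [Z1 Z1P] : forall x, exists Y, [/\ D Y, Y `<=` Z x & Dec l Y].
  by move=> x; exact: Dec_dense.
pose St := (K -> bool) -> {X | D X}.
pose le (Y X : St) := forall x, projT1 (Y x) `<=` projT1 (X x).
have le_refl X : le X X by move=> x.
have le_trans X Y W : le X Y -> le Y W -> le X W.
  by move=> XY YW x; exact: subset_trans (XY x) (YW x).
have cl : lt_closed K le.
  move=> a s sd.
  have /choice [Y YP] : forall x, exists Y : {X | D X},
      forall i, i < a -> projT1 Y `<=` projT1 (s i x).
    move=> x; have [i _|i j ij ja|Y DY Ys] := Dcl a (fun i => projT1 (s i x)).
    - exact: projT2 (s i x).
    - exact: sd.
    - by exists (exist _ Y DY).
  by exists Y => i ia x; exact: YP.
have Pref (u v : K -> bool) i : u <> v ->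
    dense_open le (fun W => Ref i (projT1 (W u)) (projT1 (W v))).
  move=> uv; split=> [X Y YX|X]; first exact: Ref_sub.
  have [U [V [DU DV UX VX UV]]] := Ref_dense i (projT2 (X u)) (projT2 (X v)).
  (* Only the coordinates [u] and [v] change; as they differ, both can be set independently. *)
  exists (fun x => if pselect (x = u) then exist _ U DU else
    if pselect (x = v) then exist _ V DV else X x).
    move=> x; case: pselect => [xu|?] /=; first by rewrite xu.
    case: pselect => [xv|?] /=; first by rewrite xv.
    exact: subset_refl.
  case: (pselect (u = u)) => // ? /=; case: (pselect (v = u)) =>
    [/esym //|?] /=.
  by case: (pselect (v = v)).
have Ppair p : cut l p.1 <> cut l p.2 -> dense_open le (fun W =>
    forall i, i < l -> Ref i (projT1 (W (cut l p.1))) (projT1 (W (cut l p.2)))).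
  move=> pp; split=> [X Y YX XP i /XP|X]; first exact: Ref_sub.
  apply: (fusion (A := [set i | i < l]) (P := fun i (W : St) =>
    Ref i (projT1 (W (cut l p.1))) (projT1 (W (cut l p.2))))
    Kwo le_refl le_trans cl (Kini l)).
  by move=> i _; exact: Pref.
have D1 x : D (Z1 x) by case: (Z1P x).
have [||Y YZ1 YP] := fusion (A := G l `&` [set p | cut l p.1 <> cut l p.2])
  (P := fun p (W : St) => forall i, i < l ->
    Ref i (projT1 (W (cut l p.1))) (projT1 (W (cut l p.2))))
  Kwo le_refl le_trans cl _ _ (fun x => exist _ (Z1 x) (D1 x)).
- by apply: card_le_lt_trans (G_lt l); apply: subset_card_le => p [].
- by move=> p [_]; exact: Ppair.
exists (fun x => projT1 (Y x)); split=> [x|x|x|p Gp pp i il].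
- exact: projT2 (Y x).
- by apply: subset_trans (YZ1 x) _; case: (Z1P x).
- by apply: Dec_sub (YZ1 x) _; case: (Z1P x).
- exact: YP.
Qed.

(** At level l, a node starts from a lower bound of the halves chosen along it, and the whole level
    is then refined by [level_refine]. The last four clauses prepare the hypotheses of
    [perfect_range], J being the level at which the bits split. *)
Lemma splitting_tree : exists (V : K -> (K -> bool) -> set T)
    (J : K -> (K -> bool) -> K),
  [/\ forall l x, D (V l x), forall i l x, i <= l -> V l x `<=` V i x,
      forall l x, Dec l (V l x),
      forall x y i, x <> y -> exists l, Ref i (V l x) (V l y) &
      [/\ forall l x y, (forall i, i < l -> x i = y i) -> J l x = J l y,
          forall l x, l <= J l x,
          forall l x y, (forall i, i < l -> x i = y i) -> forall j, j < J l x ->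
            exists m, forall t u, V m x t -> V m y u -> bit t j = bit u j &
          forall l x, exists m, forall t, V m x t -> bit t (J l x) = x l]].
Proof.
have [Kwo Kinf Kini] := Kcard; have [_ _ _ Dcl] := Dbase.
have [s lt_s lt_sE] := infinite_cardinal_succ Kcard.
have [k0 _] := infinite_setN0 Kinf.
have /choice [w wP] : forall X, exists w : K * (bool -> set T), D X -> [/\
    forall b, D (w.2 b), forall b, w.2 b `<=` X,
    forall b t, w.2 b t -> bit t w.1 = b &
    forall b b' t u i, w.2 b t -> w.2 b' u -> i < w.1 -> bit t i = bit u i].
  move=> X; have [DX|nX] := pselect (D X); last by exists (k0, fun=> set0).
  by have [j [Z jZ]] := splitting_node DX; exists (j, Z).
pose R (l : K) (V : K -> (K -> bool) -> set T) (Z : (K -> bool) -> set T) :=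
  [/\ forall x, D (Z x),
      forall x i, i < l -> Z x `<=` (w (V i (cut i x))).2 (x i),
      forall x, Dec l (Z x) &
      forall p, G l p -> cut l p.1 <> cut l p.2 ->
        forall i, i < l -> Ref i (Z (cut l p.1)) (Z (cut l p.2))].
have [||V VR] := @wo_dependent_choice _ _ Kwo _ R (fun=> set0).
- move=> l f g Z fg [DZ Zf ZDec ZRef]; split=> // x i il.
  by rewrite -fg //; exact: Zf.
- move=> l V VR.
  have Vw x i j : i < j -> j < l ->
      V j (cut j x) `<=` (w (V i (cut i x))).2 (x i).
    move=> ij jl; have [_ Vs _ _] := VR j jl.
    by have := Vs (cut j x) i ij; rewrite cut_cut ?(ltW ij) // cut_lt.
  have /choice [Z0 Z0P] : forall x, exists Z, D Z /\
      forall i, i < l -> Z `<=` (w (V i (cut i x))).2 (x i).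
    move=> x; have [i il|i j ij jl|Y DY Ys] :=
        Dcl l (fun i => (w (V i (cut i x))).2 (x i)).
    + have [DV _ _ _] := VR i il.
      by have [Dw _ _ _] := wP _ (DV (cut i x)).
    + move: ij; rewrite le_eqVlt => /predU1P [->//|ij].
      apply: subset_trans (Vw x i j ij jl).
      have [DV _ _ _] := VR j jl.
      by have [_ wV _ _] := wP _ (DV (cut j x)).
    + by exists Y.
  have [|Z [DZ ZZ0 ZDec ZRef]] := @level_refine l Z0; first by move=> x;
    case: (Z0P x).
  exists Z; split=> // x i il; apply: subset_trans (ZZ0 x) _.
  by case: (Z0P x) => _; exact.
pose U l x := V l (cut l x); pose J l x := (w (U l x)).1.
have DU l x : D (U l x) by have [DV _ _ _] := VR l; exact: DV.
have Uw i l x : i < l -> U l x `<=` (w (U i x)).2 (x i).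
  move=> il; have [_ Vs _ _] := VR l.
  by have := Vs (cut l x) i il; rewrite cut_cut ?(ltW il) // cut_lt.
have wU i x b : (w (U i x)).2 b `<=` U i x by have [_ + _ _] := wP _ (DU i x);
  exact.
have U_local l x y : (forall i, i < l -> x i = y i) -> U l x = U l y.
  by move=> /cut_eq xy; rewrite /U xy.
have bitJ l x t : U (s l) x t -> bit t (J l x) = x l.
  by move=> /(Uw l _ _ (lt_s l)) tw; have [_ _ + _] := wP _ (DU l x); apply.
(* Otherwise both halves of the split at l would lie in one half of the split at i, where all bits
   up to [J i x] are constant. *)
have J_incr x i l : i < l -> J i x < J l x.
  move=> il; rewrite ltNge; apply/negP => Jli.
  have [Dw wUl wb _] := wP _ (DU l x).
  have [_ _ wbi wi] := wP _ (DU i x).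
  have [t wt] := base_nonempty Dbase (Dw true).
  have [u wu] := base_nonempty Dbase (Dw false).
  suff : bit t (J l x) = bit u (J l x) by rewrite (wb _ _ wt) (wb _ _ wu).
  have tU := Uw _ _ _ il _ (wUl _ _ wt); have uU := Uw _ _ _ il _ (wUl _ _ wu).
  move: Jli; rewrite le_eqVlt => /predU1P [->|Jli].
    by rewrite (wbi _ _ tU) (wbi _ _ uU).
  exact: (wi _ _ _ _ _ tU uU).
exists U, J; split=> [|i l x|l x|x y i xy|] //.
- rewrite le_eqVlt => /predU1P [->//|il].
  exact: subset_trans (Uw _ _ _ il) (wU _ _ _).
- by have [_ _ VDec _] := VR l; exact: VDec.
- have /existsNP [k xyk] : ~ forall k, x k = y k by move=> /funext.
  (* The guess is taken beyond [k], so that the two nodes are distinct, and beyond [i], so that the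
     index [i] is treated. *)
  have [l [p [al Gp px py]]] := G_guess x y (Order.max (s i) (s k)).
  move: al; rewrite ge_max => /andP [/(lt_le_trans (lt_s i)) il /(lt_le_trans
    (lt_s k)) kl].
  exists l; have [_ _ _ /(_ p Gp)] := VR l.
  rewrite (cut_eq px) (cut_eq py); apply=> // /(congr1 (@^~ k)).
  by rewrite /cut kl.
- split=> [l x y xy|l x|l x y xy j jJ|l x].
  + by rewrite /J (U_local _ _ _ xy).
  + by apply: (strict_mono_ge Kwo (f := J^~ x)) => i j; exact: J_incr.
  + exists (s l) => t u /(Uw _ _ _ (lt_s l)) tw /(Uw _ _ _ (lt_s l)).
    rewrite -(U_local _ _ _ xy) => uw; have [_ _ _] := wP _ (DU l x).
    by apply; [exact: tw|exact: uw|exact: jJ].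
  + by exists (s l) => t; exact: bitJ.
Qed.

End Tree.

(** * The perfect family of models *)

(** Variables are elements of K, so at the valuation [id] the atomic formulas are the atomic
    diagram. *)
Lemma fragment_model_ext (K : Type) (L : vocabulary) (F : set (fml K L)) (M M'
  : Mod K L) :
  fragment F -> (forall chi, F chi -> sat M id chi <-> sat M' id chi) -> M = M'.
Proof.
move=> [_ _ [_ FRel] _] MM'; apply: functional_extensionality_dep => R.
apply: funext => s; apply/propext; have := MM' _ (FRel R s).
by rewrite /= (_ : map_tuple id s = s) //; apply: val_inj; rewrite /= map_id.
Qed.

Section PerfectFamily.
Context {d d' : Order.disp_t} {K : orderType d} {Kp : orderType d'}.
Context (Kcard : infinite_cardinal K) (Kps : successor_cardinal K Kp).
Context (Kreg : regular K) (Kguess : diamond K \/ inaccessible K).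
Context (D : set (set Kp)).
Context (Dbase : deciding_base K D).
Context (L : vocabulary) (H : set (K -> K)) (F : set (fml K L)).
Context (Ffrag : fragment F).
Context (phi : K -> fml K L).
Context (F_phi : forall j, F (phi j))
  (phi_F : forall chi, F chi -> exists j, phi j = chi).
Context (Hs : K -> set (K -> K)).
Context (Hs_ref : forall i, boundedly_refutable F phi (Hs i))
  (HE : H = \bigcup_i Hs i).
Context (psi : sigma11 K L) (A : Kp -> Mod K L).
Context (A_psi : forall t, models psi (A t))
  (A_emb : forall t u, t <> u -> ~ elem_embeddable F H (A t) (A u))
  (A_inj : injective A).

(* M could be the limit model of a branch through X. *)
Definition compatible (X : set Kp) (M : Mod K L) : Prop := forall j,
  ((forall t, X t -> sat (A t) id (phi j)) -> sat M id (phi j)) /\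
  ((forall t, X t -> ~ sat (A t) id (phi j)) -> ~ sat M id (phi j)).

Definition refuted (i : K) (X Y : set Kp) : Prop := forall M M',
  compatible X M -> compatible Y M' -> ~ elem_embeddable F (Hs i) M M'.

Definition bit (t : Kp) (j : K) : bool := `[< sat (A t) id (phi j) >].

Lemma compatible_sub X X' M : X' `<=` X -> compatible X' M -> compatible X M.
Proof.
by move=> XX' MX j; split=> XP; apply MX => t /XX' /XP.
Qed.

Lemma bit_sep t u : t <> u -> exists j, bit t j <> bit u j.
Proof.
move=> tu; apply: contrapT => /forallNP bb; apply/tu/A_inj.
apply: (fragment_model_ext Ffrag) => _ /phi_F [j <-].
exact: asbool_eq_equiv (contrapT (bb j)).
Qed.

Lemma refuted_dense i X Y : D X -> D Y -> exists X' Y',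
  [/\ D X', D Y', X' `<=` X, Y' `<=` Y & refuted i X' Y'].
Proof.
move=> DX DY; have [t0 _] := base_nonempty Dbase DX.
have [t [Xt _ tP]] := approximable_point Kcard Dbase bit t0 DX.
have [u [Yu ut uP]] := approximable_point Kcard Dbase bit t DY.
have [b bP] : exists b, forall M M',
    (forall j, j < b -> sat (A t) id (phi j) <-> sat M id (phi j)) ->
    (forall j, j < b -> sat (A u) id (phi j) <-> sat M' id (phi j)) ->
    ~ elem_embeddable F (Hs i) M M'.
  apply: Hs_ref => -[h Hh hP]; apply: (A_emb (t := t) (u := u)).
    by move=> tu; apply: ut.
  by exists h => //; rewrite HE; exists i.
have [X' [DX' X'X X't]] := tP b; have [Y' [DY' Y'Y Y'u]] := uP b.
exists X', Y'; split=> // M M' MX' MY'.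
have agree v Z N : compatible Z N -> (forall w j, Z w -> j < b ->
  bit w j = bit v j) ->
    forall j, j < b -> sat (A v) id (phi j) <-> sat N id (phi j).
  move=> NZ Zv j jb; have [NZ1 NZ2] := NZ j; split=> [sv|sN].
    by apply: NZ1 => w Zw; apply/asboolP; rewrite -/(bit w j) Zv //;
      exact/asboolP.
  apply: contrapT => nsv; apply: NZ2 sN => w Zw; apply/asboolPn.
  by rewrite -/(bit w j) Zv //; exact/asboolPn.
by apply: bP; [exact: agree MX' X't|exact: agree MY' Y'u].
Qed.

Lemma perfect_family : exists AL : (K -> bool) -> Mod K L,
  [/\ forall x, models psi (AL x),
      pairwise_non_embeddable F H (range AL) &
      perfect_subset (cantor_in_baire
        (range (fun x j => `[< sat (AL x) id (phi j) >])))].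
Proof.
have [Kwo Kinf _] := Kcard; have [z0 _] := infinite_setN0 Kinf.
(* Witnesses for the new relations are fixed, so that truth of the matrix can be decided in the
   expanded models. *)
have /choice [B BP] : forall t, exists B : Mod K (new_rel psi), forall a,
    sat (expansion (A t) B) a (sigma_matrix psi).
  by move=> t; have [B BP] := A_psi t; exists B.
pose N t := expansion (A t) (B t).
have [FK Fcard [FEq _] [_ Fsub _]] := Ffrag.
have Fle : F #<= [set: K] by move: Fcard; rewrite card_eq_le => /andP [].
have [|tau1 [tau1F tau1P]] := task_enumeration z0 Kcard Kps Dbase
    (homogeneous_card_le Kcard Dbase Fle).
  by exists (Equ z0 z0).
have [|tau2 [tau2F tau2P]] := task_enumeration z0 Kcard Kps Dbase
    (homogeneous_subformula Kcard Dbase (phi := sigma_matrix psi)).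
  by exists (sigma_matrix psi); exact: subformula_refl.
pose Dec l X := decides A X (tau1 l).1 (tau1 l).2 /\
  decides N X (tau2 l).1 (tau2 l).2.
have [G [G_lt G_guess]] : exists G : K -> set ((K -> bool) * (K -> bool)),
    (forall a, G a #< [set: K]) /\
    forall x y (a : K), exists l p, [/\ a <= l, G l p,
      forall i, i < l -> p.1 i = x i & forall i, i < l -> p.2 i = y i].
  (* The coding of K * bool in K is obtained from homogeneity. *)
  apply: guessing_pairs => //; apply: (card_le_homogeneous Kps Dbase).
  rewrite -setXTT. apply: homogeneous_setX.
    exact: (homogeneous_card_le Kcard Dbase).
  exact: (homogeneous_bool Kcard Dbase).
have [||||V [J [DV V_anti VDec VRef [J_local J_ge V_local V_J]]]] :=
    splitting_tree Kcard Dbase bit_sep (Dec := Dec) (Ref :=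
      refuted) _ _ _ _ G_lt G_guess.
- by move=> i X Y YX [d1 d2]; split; exact: decides_sub YX _.
- move=> i X DX.
  have [Y [DY YX Y1]] := base_decides Kcard Dbase A (tau1 i).2 (FK _ (tau1F i))
    DX.
  have [|Z [DZ ZY Z2]] := base_decides Kcard Dbase N (tau2 i).2 (chi :=
    (tau2 i).1) _ DY.
    exact: subformula_in_logic (tau2F i) (sigma_matrix_logic psi).
  exists Z; split=> //; first exact: subset_trans ZY YX.
  by split=> //; exact: decides_sub ZY Y1.
- move=> i X Y X' Y' X'X Y'Y XY M M' MX' MY'.
  by apply: XY; [exact: compatible_sub MX'|exact: compatible_sub MY'].
- exact: refuted_dense.
have V_ne x l : V l x !=set0 by exact: (base_nonempty Dbase).
have V_anti' x i j : i <= j -> V j x `<=` V i x by exact: V_anti.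
pose AL x : Mod K L := limit_model A (V^~ x).
have satAL x chi a : F chi -> sat (AL x) a chi <->
    exists l, forall t, V l x t -> sat (A t) a chi.
  move=> Fchi; apply: (sat_limit_model (V_anti' x) (V_ne x) Kreg (FK _ Fchi)).
  move=> chi' sub b bz; have [l tl] := tau1P chi' b (Fsub _ _ Fchi sub) bz.
  by exists l; have [] := VDec l x; rewrite tl.
have AL_compat x l : compatible (V l x) (AL x).
  move=> j; split=> [lP|lN]; first by apply/satAL => //; exists l.
  move=> /(satAL _ _ _ (F_phi j)) sP.
  by apply: (eventually_absurd (V_anti' x) (V_ne x) sP); exists l.
exists AL; split=> [x||].
- exists (limit_model B (V^~ x)) => a.
  (* Limits commute with expansions, so the limit of the witnesses is a witness for the limit
     model. *)
  have -> : expansion (AL x) (limit_model B (V^~ x)) = limit_model N (V^~ x).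
    by apply: functional_extensionality_dep => -[].
  apply/(sat_limit_model (V_anti' x) (V_ne x) Kreg (sigma_matrix_logic psi)).
  + move=> chi sub b bz; have [l tl] := tau2P chi b sub bz.
    by exists l; have [] := VDec l x; rewrite tl.
  + by exists z0 => t _; exact: BP.
- move=> _ _ [x _ <-] [y _ <-] xy [h]; rewrite HE => -[i _ hi] hP.
  have [|l] := VRef x y i; first by move=> xy'; apply: xy; rewrite xy'.
  by move=> /(_ _ _ (AL_compat x l) (AL_compat y l)); apply; exists h.
- apply: (perfect_range Kcard Kreg J_local J_ge) => [l x y xy j jJ|l x].
    have imp x' y' : (exists m, forall t u, V m x' t -> V m y' u ->
      bit t j = bit u j) ->
        sat (AL x') id (phi j) -> sat (AL y') id (phi j).
      move=> [m mP] /(satAL _ _ _ (F_phi j)) [k kP]; apply/satAL => //;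
        exists m => u Vu.
      have [t Vt] := V_ne x' (Order.max k m).
      apply/asboolP; rewrite -/(bit u j) -(mP t u) //.
        by apply/asboolP/kP; apply: V_anti Vt; rewrite le_max lexx.
      by apply: V_anti Vt; rewrite le_max lexx orbT.
    have [m mP] := V_local l x y xy j jJ.
    apply: asbool_equiv_eq; split; apply: imp; first by exists m.
    by exists m => t u Vt Vu; apply/esym; exact: mP.
  have [m mP] := V_J l x; have [pos neg] := AL_compat x m (J l x).
  case xl : (x l) mP => mP.
    by apply/asboolP/pos => t /mP /asboolP.
  by apply/asboolPn/neg => t /mP /asboolPn.
Qed.

End PerfectFamily.

Theorem theorem3p8
  (d d' : Order.disp_t) (K : orderType d) (Kp : orderType d')
  (K_card : infinite_cardinal K) (Kp_succ : successor_cardinal K Kp)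
  (K_Iminus : I_minus K Kp)
  (K_diamond : diamond K \/ inaccessible K)
  (L : vocabulary) (L_small : [set: relsym L] #<= [set: K])
  (H : set (K -> K)) (H_inj : forall h, H h -> injective h)
  (F : set (fml K L)) (F_frag : fragment F)
  (e : F -> K) (e_bij : bijective e)
  (psi : sigma11 K L)
  (H_K_kappa :
     @K_kappa K [set: K] (baire K) H \/
     (@K_kappa K [set: K] {ptws K -> discrete_topology K} H /\
      F `<=` in_logic nat)) :
  (exists S : set (Mod K L),
     [/\ S `<=` models psi, [set: Kp] #<= S &
         pairwise_non_embeddable F H S]) ->
  perfectly_many e H psi.
Proof.
move=> [S [Spsi /card_le_injT [A SA A_inj] Semb]].
have [Kreg [D Dbase]] := I_minus_base K_card Kp_succ K_Iminus.
have [e' eK e'K] := e_bij.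
(* Enumerating F by the inverse of [e] identifies the bits of a model with its image under [i_map],
   in the coordinates of [t_perfect]. *)
pose phi j : fml K L := val (e' j).
have F_phi j : F (phi j) by exact: set_valP.
have phi_F chi : F chi -> exists j, phi j = chi.
  by move=> Fchi; exists (e (SigSub (mem_set Fchi))); rewrite /phi eK.
have [Hs [Hs_ref HE]] := K_kappa_boundedly_refutable K_card Kreg F_frag phi_F
  H_K_kappa.
have [||AL [AL_psi AL_emb AL_perf]] := perfect_family K_card Kp_succ Kreg
  K_diamond
    Dbase F_frag F_phi phi_F Hs_ref HE (psi := psi) (A := A) _ _ A_inj.
- by move=> t; exact: Spsi.
- by move=> t u tu; apply: Semb => // /A_inj.
exists (range AL); split=> [_ [x _ <-]||] //.
rewrite /t_perfect; congr (perfect_subset (cantor_in_baire _)): AL_perf.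
apply/seteqP; split=> [_ [x _ <-]|y [_ [x _ <-] xy]] /=.
  by exists (AL x); [exists x|apply: funext => chi; rewrite /i_map /phi eK].
exists x => //; apply: funext => j; have := congr1 (@^~ (e' j)) xy.
by rewrite /i_map /= e'K.
Qed.
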